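(* Let $k$ be an algebraically closed field and let $\mathcal{C}$ be a connected, skeletal finite EI category. Then the category algebra $k\mathcal{C}$ is hereditary if and only if $\mathcal{C}$ is a finite free EI category such that the endomorphism groups of all objects of $\mathcal{C}$ have orders invertible in $k$.
   Context: A finite EI category is a small category with finitely many morphisms in which every endomorphism is an isomorphism. It is skeletal if isomorphic objects are equal, and connected if any two objects are joined by a finite chain of objects in which consecutive ones have a morphism between them in some direction. Composition is from right to left. The category algebra $k\mathcal{C}$ has the morphisms of $\mathcal{C}$ as a $k$-basis, with product $\alpha*\beta=\alpha\circ\beta$ if composable and $0$ otherwise. A finite EI quiver is a datum $\hat Q=(Q_0,Q_1,s,t,f,g)$ where $(Q_0,Q_1,s,t)$ is a finite acyclic quiver, $f$ assigns a finite group $f(v)$ to each vertex $v$, and $g$ assigns an $(f(t(\alpha)),f(s(\alpha)))$-biset to each arrow $\alpha$. It generates a category $\mathcal{C}_{\hat Q}$ with object set $Q_0$, $\mathrm{End}(v)=f(v)$, and, for $v\neq w$, $\mathrm{Hom}(v,w)=\bigsqcup_\gamma H_\gamma$ over all directed paths $\gamma$ from $v$ to $w$, where for $\gamma$ the path $v=v_0\xrightarrow{\alpha_1}v_1\to\cdots\xrightarrow{\alpha_n}v_n=w$, $H_\gamma=g(\alpha_n)\times_{f(v_{n-1})}\cdots\times_{f(v_1)}g(\alpha_1)$ (biset product: $X\times_K Y=(X\times Y)/((xk,y)\sim(x,ky))$). Composition is induced by the natural maps $H_{\gamma_2}\times H_{\gamma_1}\to H_{\gamma_2}\times_{f(v)}H_{\gamma_1}=H_{\gamma_2\gamma_1}$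 and by the group multiplications and actions. A finite EI category is a finite free EI category if it is isomorphic to some $\mathcal{C}_{\hat Q}$. *)

(* Defs.v *)
From HB Require Import structures.
Set Warnings "-notation-overridden,-ambiguous-paths,-redundant-canonical-projection".
From mathcomp Require Import all_boot all_order all_algebra all_fingroup.

Set Implicit Arguments.
Unset Strict Implicit.
Unset Printing Implicit Defensive.

Import GRing.Theory.
Local Open Scope ring_scope.

(** * Categories *)

Record catLaws (ob : Type) (mor : ob -> ob -> Type) := CatLaws {
  mid : forall x, mor x x;
  (* right-to-left composition: [mcomp g f] is g o f *)
  mcomp : forall x y z, mor y z -> mor x y -> mor x z;
  mcompA : forall x y z w (h : mor z w) (g : mor y z) (f : mor x y),
    mcomp h (mcomp g f) = mcomp (mcomp h g) f;
  mcomp1m : forall x y (f : mor x y), mcomp (mid y) f = f;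
  mcompm1 : forall x y (f : mor x y), mcomp f (mid x) = f
}.

Record category := Category {
  cob : Type;
  cmor : cob -> cob -> Type;
  cat_laws : catLaws cmor
}.

Record fincat := FinCat {
  ob : finType;
  mor : ob -> ob -> finType;
  fincat_laws : catLaws mor
}.

Coercion cat_of_fincat (C : fincat) : category := Category (fincat_laws C).

Definition cat_id (C : category) (x : cob C) : cmor x x := mid (cat_laws C) x.

Definition cat_comp (C : category) (x y z : cob C)
  (g : cmor y z) (f : cmor x y) : cmor x z := mcomp (cat_laws C) g f.

Definition fincat_id (C : fincat) (x : ob C) : mor x x := mid (fincat_laws C) x.

Definition fincat_comp (C : fincat) (x y z : ob C)
  (g : mor y z) (f : mor x y) : mor x z := mcomp (fincat_laws C) g f.

Definition is_iso (C : category) (x y : cob C) (f : cmor x y) : Prop :=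
  exists g : cmor y x, cat_comp g f = cat_id x /\ cat_comp f g = cat_id y.

Definition EI (C : category) : Prop :=
  forall (x : cob C) (f : cmor x x), is_iso f.

Definition skeletal (C : category) : Prop :=
  forall x y : cob C, (exists f : cmor x y, is_iso f) -> x = y.

(* [connect] is the reflexive transitive closure of a relation on a finType. *)
Definition cat_connected (C : fincat) : Prop :=
  forall x y : ob C,
    connect (fun u v : ob C => (0 < #|mor u v|)%N || (0 < #|mor v u|)%N) x y.

(** * Functors and isomorphisms of categories *)

Record functor (C D : category) := Functor {
  fob : cob C -> cob D;
  fmor : forall x y, cmor x y -> cmor (fob x) (fob y);
  fmor_id : forall x, fmor (cat_id x) = cat_id (fob x);
  fmor_comp : forall x y z (g : cmor y z) (f : cmor x y),
    fmor (cat_comp g f) = cat_comp (fmor g) (fmor f)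
}.

(* Morphisms bundled with source and target, so that equations between values
   of functors do not require transporting along equations between objects. *)
Definition carrow (C : category) : Type :=
  {p : cob C * cob C & cmor p.1 p.2}.

Definition carr (C : category) (x y : cob C) (f : cmor x y) : carrow C :=
  existT (fun p : cob C * cob C => cmor p.1 p.2) (x, y) f.

Definition farrow (C D : category) (F : functor C D) (m : carrow C) : carrow D :=
  carr (fmor F (projT2 m)).

Definition cat_isomorphic (C D : category) : Prop :=
  exists (F : functor C D) (G : functor D C),
    [/\ cancel (fob F) (fob G), cancel (fob G) (fob F),
        cancel (farrow F) (farrow G) & cancel (farrow G) (farrow F)].

(** * Bisets *)

(* A (G, H)-biset: G acts on the left, H on the right, and the actions commute. *)
Record biset (G H : finGroupType) := Biset {
  bset :> finType;
  blact : G -> bset -> bset;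
  bract : bset -> H -> bset;
  lact1 : forall x, blact 1%g x = x;
  lactM : forall a b x, blact (a * b)%g x = blact a (blact b x);
  ract1 : forall x, bract x 1%g = x;
  ractM : forall x a b, bract x (a * b)%g = bract (bract x a) b;
  lractA : forall a x b, blact a (bract x b) = bract (blact a x) b
}.

Section BisetProduct.

Variables (G K H : finGroupType) (X : biset G K) (Y : biset K H).

(* (x k, y) ~ (x, k y); this relation is already an equivalence. *)
Definition bprod_rel (p q : X * Y) : bool :=
  [exists k : K, (p.1 == bract q.1 k) && (q.2 == blact k p.2)].

Lemma bprod_rel_refl : reflexive bprod_rel.
Proof. by move=> p; apply/existsP; exists 1%g; rewrite ract1 lact1 !eqxx. Qed.

Lemma bprod_rel_sym : symmetric bprod_rel.
Proof.
have sub p q : bprod_rel p q -> bprod_rel q p.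
  case/existsP=> k /andP[/eqP e1 /eqP e2]; apply/existsP; exists k^-1%g.
  by rewrite e1 e2 -ractM mulgV ract1 -lactM mulVg lact1 !eqxx.
by move=> p q; apply/idP/idP; apply: sub.
Qed.

Lemma bprod_rel_trans : transitive bprod_rel.
Proof.
move=> q p r /existsP[a /andP[/eqP e1 /eqP e2]] /existsP[b /andP[/eqP e3 /eqP e4]].
by apply/existsP; exists (b * a)%g; rewrite ractM -e3 -e1 lactM -e2 -e4 !eqxx.
Qed.

Canonical bprod_equiv :=
  EquivRel bprod_rel bprod_rel_refl bprod_rel_sym bprod_rel_trans.

Local Open Scope quotient_scope.

Definition bprod_set : finType := quot_type {eq_quot bprod_rel}.

Definition bcls (x : X) (y : Y) : bprod_set :=
  \pi_({eq_quot bprod_rel}) (x, y).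

Definition brep (q : bprod_set) : X * Y :=
  generic_quotient.repr (q : {eq_quot bprod_rel}).

Lemma brepK q : bcls (brep q).1 (brep q).2 = q.
Proof. by rewrite /bcls -surjective_pairing; apply: reprK. Qed.

Lemma bcls_eq x k y : bcls (bract x k) y = bcls x (blact k y).
Proof. by apply/eqmodP/existsP; exists k; rewrite !eqxx. Qed.

Lemma bprodP (q : bprod_set) : exists x y, q = bcls x y.
Proof. by exists (brep q).1, (brep q).2; rewrite brepK. Qed.

(* Functions on the biset product are defined below by evaluating on a
   representative; this is independent of the representative. *)
Lemma bprod_factor (T : Type) (F : X -> Y -> T) :
  (forall x k y, F (bract x k) y = F x (blact k y)) ->
  forall x y, F (brep (bcls x y)).1 (brep (bcls x y)).2 = F x y.
Proof.
move=> Fk x y; have /eqmodP/existsP[k] := brepK (bcls x y).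
by move=> /andP[/eqP/= -> /eqP/= e2]; rewrite Fk -e2.
Qed.

Definition bprod_lact (a : G) (q : bprod_set) : bprod_set :=
  bcls (blact a (brep q).1) (brep q).2.

Definition bprod_ract (q : bprod_set) (b : H) : bprod_set :=
  bcls (brep q).1 (bract (brep q).2 b).

Lemma bprod_lactE a x y : bprod_lact a (bcls x y) = bcls (blact a x) y.
Proof.
apply: (bprod_factor (F := fun x y => bcls (blact a x) y)) => {}x k {}y.
by rewrite lractA bcls_eq.
Qed.

Lemma bprod_ractE x y b : bprod_ract (bcls x y) b = bcls x (bract y b).
Proof.
apply: (bprod_factor (F := fun x y => bcls x (bract y b))) => {}x k {}y.
by rewrite bcls_eq lractA.
Qed.

Fact bprod_lact1 q : bprod_lact 1%g q = q.
Proof. by have [x [y ->]] := bprodP q; rewrite bprod_lactE lact1. Qed.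

Fact bprod_lactM a b q : bprod_lact (a * b)%g q = bprod_lact a (bprod_lact b q).
Proof. by have [x [y ->]] := bprodP q; rewrite !bprod_lactE lactM. Qed.

Fact bprod_ract1 q : bprod_ract q 1%g = q.
Proof. by have [x [y ->]] := bprodP q; rewrite bprod_ractE ract1. Qed.

Fact bprod_ractM q a b : bprod_ract q (a * b)%g = bprod_ract (bprod_ract q a) b.
Proof. by have [x [y ->]] := bprodP q; rewrite !bprod_ractE ractM. Qed.

Fact bprod_lractA a q b :
  bprod_lact a (bprod_ract q b) = bprod_ract (bprod_lact a q) b.
Proof.
by have [x [y ->]] := bprodP q; rewrite bprod_ractE !bprod_lactE bprod_ractE.
Qed.

Definition bprod : biset G H :=
  @Biset G H bprod_set bprod_lact bprod_ract bprod_lact1 bprod_lactM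
    bprod_ract1 bprod_ractM bprod_lractA.

End BisetProduct.

(** * Finite EI quivers and the categories they generate *)

Section Paths.

Variables (Q0 Q1 : Type) (s t : Q1 -> Q0).

(* Directed paths of positive length; [pcons a p] travels p first, then a. *)
Inductive dpath : Q0 -> Q0 -> Type :=
| parr (a : Q1) : dpath (s a) (t a)
| pcons v (a : Q1) (p : dpath v (s a)) : dpath v (t a).

(* [pcat p2 p1] is the path p2 p1, i.e. first p1, then p2. *)
Fixpoint pcat u v w (p2 : dpath v w) : dpath u v -> dpath u w :=
  match p2 in dpath v w return dpath u v -> dpath u w with
  | parr a => fun p1 => pcons p1
  | pcons v a p => fun p1 => pcons (pcat p p1)
  end.

End Paths.

Arguments parr {Q0 Q1 s t} a.
Arguments pcons {Q0 Q1 s t v} a p.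

Record EIquiver := EIQuiver {
  qvert : finType;
  qarr : finType;
  qsrc : qarr -> qvert;
  qtgt : qarr -> qvert;
  qacyclic : forall v, dpath qsrc qtgt v v -> False;
  qgrp : qvert -> finGroupType;
  qbis : forall a : qarr, biset (qgrp (qtgt a)) (qgrp (qsrc a))
}.

Section GeneratedCategory.

Variable Q : EIquiver.

Local Notation path := (dpath (@qsrc Q) (@qtgt Q)).
Local Notation f := (@qgrp Q).
Local Notation g := (@qbis Q).

Fixpoint Hpath v w (p : path v w) : biset (f w) (f v) :=
  match p in dpath _ _ v w return biset (f w) (f v) with
  | parr a => g a
  | pcons v a p => bprod (g a) (Hpath p)
  end.

(* The natural map H_p2 x H_p1 -> H_(p2 p1), by recursion on p2: it sends
   ([a, z], y) to [a, (z, y)] ([Hcomp_pcons]), and it is balanced over the group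
   at the middle vertex ([Hcomp_bal]). *)
Fixpoint Hcomp u v w (p2 : path v w) :
    forall p1 : path u v, Hpath p2 -> Hpath p1 -> Hpath (pcat p2 p1) :=
  match p2 in dpath _ _ v w
    return forall p1 : path u v, Hpath p2 -> Hpath p1 -> Hpath (pcat p2 p1)
  with
  | parr a => fun p1 x y => @bcls _ _ _ (g a) (Hpath p1) x y
  | pcons v a p => fun p1 x y =>
      @bcls _ _ _ (g a) (Hpath (pcat p p1)) (brep x).1 (Hcomp (brep x).2 y)
  end.

Lemma Hcomp_lact u v w (p2 : path v w) (p1 : path u v) k
    (x : Hpath p2) (y : Hpath p1) :
  Hcomp (blact k x) y = blact k (Hcomp x y).
Proof.
elim: p2 p1 k x y => [a|v' a p2 IH] p1 k x y; first by rewrite /= bprod_lactE.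
rewrite /= bprod_lactE /bprod_lact.
apply: (bprod_factor (F := fun b z => bcls b (Hcomp z y))) => {}x j z.
by rewrite IH bcls_eq.
Qed.

Lemma Hcomp_pcons u v (a : qarr Q) (p2 : path v (qsrc a)) (p1 : path u v)
    (x : g a) (z : Hpath p2) (y : Hpath p1) :
  Hcomp (p2 := pcons a p2) (bcls x z) y = bcls x (Hcomp z y).
Proof.
apply: (bprod_factor (F := fun b z => bcls b (Hcomp z y))) => {}x j {}z.
by rewrite Hcomp_lact bcls_eq.
Qed.

Lemma Hcomp_ract u v w (p2 : path v w) (p1 : path u v)
    (x : Hpath p2) (y : Hpath p1) k :
  Hcomp x (bract y k) = bract (Hcomp x y) k.
Proof.
elim: p2 p1 x y k => [a|v' a p2 IH] p1 x y k; first by rewrite /= bprod_ractE.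
by have [b [z ->]] := bprodP x; rewrite !Hcomp_pcons /= bprod_ractE IH.
Qed.

Lemma Hcomp_bal u v w (p2 : path v w) (p1 : path u v)
    (x : Hpath p2) (y : Hpath p1) k :
  Hcomp (bract x k) y = Hcomp x (blact k y).
Proof.
elim: p2 p1 x y k => [a|v' a p2 IH] p1 x y k; first by rewrite /= bcls_eq.
have [b [z ->]] := bprodP x.
by rewrite /= bprod_ractE [LHS]Hcomp_pcons [RHS]Hcomp_pcons IH.
Qed.

(* By acyclicity [QPath] only produces morphisms between distinct vertices, so
   Hom(v, v) consists of the [QEnd x] with x in f(v), and, for v <> w, Hom(v, w)
   is the disjoint union of the H_p over the paths p from v to w. *)
Inductive qhom : qvert Q -> qvert Q -> Type :=
| QEnd v (x : f v) : qhom v v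
| QPath v w (p : path v w) (x : Hpath p) : qhom v w.

Lemma qhom_end v (h : qhom v v) : exists x, h = QEnd x.
Proof.
suff gen u (h' : qhom u v) (e : u = v) :
    exists x, ecast z (qhom z v) e h' = QEnd x by apply: gen (erefl v).
case: {u v h} h' e => [v x|v w p x] e; first by exists x; rewrite eq_axiomK.
by subst w; case: (qacyclic p).
Qed.

Lemma qhom_path v w (h : qhom v w) : v != w -> exists p (x : Hpath p), h = QPath x.
Proof. by case: h => [{}v x|{}v {}w p x]; [rewrite eqxx | exists p, x]. Qed.

Definition qid v : qhom v v := QEnd (1%g : f v).

Definition qcomp u v w (h2 : qhom v w) : qhom u v -> qhom u w :=
  match h2 in qhom v w return qhom u v -> qhom u w with
  | QEnd v a => fun h1 =>
      match h1 in qhom u v return f v -> qhom u v with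
      | QEnd _ b => fun a => QEnd (a * b)%g
      | QPath _ _ _ y => fun a => QPath (blact a y)
      end a
  | QPath v w p2 x => fun h1 =>
      match h1 in qhom u v
        return forall p2 : path v w, Hpath p2 -> qhom u w with
      | QEnd _ b => fun _ x => QPath (bract x b)
      | QPath _ _ _ y => fun _ x => QPath (Hcomp x y)
      end p2 x
  end.

Lemma HcompA u v w z (p3 : path w z) (p2 : path v w) (p1 : path u v)
    (x3 : Hpath p3) (x2 : Hpath p2) (x1 : Hpath p1) :
  QPath (Hcomp x3 (Hcomp x2 x1)) = QPath (Hcomp (Hcomp x3 x2) x1).
Proof.
pose tot u' v' (p : path u' v') (x : Hpath p) : {q : path u' v' & Hpath q} :=
  existT _ p x.
suff: tot _ _ _ (Hcomp x3 (Hcomp x2 x1)) = tot _ _ _ (Hcomp (Hcomp x3 x2) x1).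
  by move/(congr1 (fun q => QPath (projT2 q))).
elim: p3 p2 x2 x3 => [a|v' a p3 IH] p2 x2 x3.
  apply: (congr1 (tot _ _ (pcons a (pcat p2 p1)))).
  exact: esym (Hcomp_pcons x3 x2 x1).
have [b [y ->]] := bprodP x3.
apply: etrans (congr1 (tot _ _ (pcons a (pcat p3 (pcat p2 p1))))
  (Hcomp_pcons b y (Hcomp x2 x1))) _.
apply: etrans (congr1 (fun q => tot _ _ (pcons a (projT1 q)) (bcls b (projT2 q)))
  (IH p2 x2 y)) _.
apply: (congr1 (tot _ _ (pcons a (pcat (pcat p3 p2) p1)))).
apply: etrans (esym (Hcomp_pcons b (Hcomp y x2) x1)) _.
apply: (congr1 (fun h => Hcomp (p2 := pcons a (pcat p3 p2)) h x1)).
exact: esym (Hcomp_pcons b y x2).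
Qed.

Lemma qcompA u v w z (h3 : qhom w z) (h2 : qhom v w) (h1 : qhom u v) :
  qcomp h3 (qcomp h2 h1) = qcomp (qcomp h3 h2) h1.
Proof.
case: h3 h2 => [{}w c|{}w {}z p3 x3] h2.
  case: h2 h1 c => [{}v b|{}v {}w p2 x2] h1 c.
    by case: h1 b c => [{}u a|{}u {}v p1 x1] b c /=; rewrite ?mulgA ?lactM.
  by case: h1 p2 x2 => [{}u a|{}u {}v p1 x1] p2 x2 /=; rewrite ?lractA ?Hcomp_lact.
case: h2 h1 p3 x3 => [{}v b|{}v {}w p2 x2] h1 p3 x3.
  by case: h1 b p3 x3 => [{}u a|{}u {}v p1 x1] b p3 x3 /=;
    rewrite ?ractM ?Hcomp_bal.
case: h1 p2 x2 => [{}u a|{}u {}v p1 x1] p2 x2 /=; first by rewrite Hcomp_ract.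
exact: HcompA.
Qed.

Lemma qcomp1m u v (h : qhom u v) : qcomp (qid v) h = h.
Proof. by case: h => [{}v x|{}u {}v p x] /=; rewrite ?mul1g ?lact1. Qed.

Lemma qcompm1 u v (h : qhom u v) : qcomp h (qid u) = h.
Proof. by case: h => [{}v x|{}u {}v p x] /=; rewrite ?mulg1 ?ract1. Qed.

Definition qcat : category := Category (CatLaws qcompA qcomp1m qcompm1).

End GeneratedCategory.

Definition free_EI (C : fincat) : Prop :=
  exists Q : EIquiver, cat_isomorphic C (qcat Q).

(** * The category algebra *)

Section CategoryAlgebra.

Variables (k : fieldType) (C : fincat).

Definition arrow : finType := {p : ob C * ob C & mor p.1 p.2}.

Definition arr (x y : ob C) (f : mor x y) : arrow :=
  existT (fun p : ob C * ob C => mor p.1 p.2 : Type) (x, y) f.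

Definition catalg : Type := {ffun arrow -> k^o}.

HB.instance Definition _ := GRing.Lmodule.copy catalg {ffun arrow -> k^o}.

Definition catalg_basis (m : arrow) : catalg := [ffun m' => (m' == m)%:R].

Definition catalg_one : catalg := \sum_(x : ob C) catalg_basis (arr (fincat_id x)).

(* The coefficient of m : x -> z in a * b is the sum of a(g) b(f) over all
   factorizations m = g o f. *)
Definition catalg_mul (a b : catalg) : catalg :=
  [ffun m : arrow => \sum_(y : ob C) \sum_(f : mor (tag m).1 y)
     \sum_(g : mor y (tag m).2 | fincat_comp g f == tagged m) a (arr g) * b (arr f)].

Lemma arr_inj x y : injective (@arr x y).
Proof. by move=> f f' /eqP; rewrite /arr eq_Tagged /= => /eqP. Qed.

Lemma catalg_ext (a b : catalg) :
  (forall x y (h : mor x y), a (arr h) = b (arr h)) -> a = b.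
Proof. by move=> E; apply/ffunP => -[[x y] h]; apply: E. Qed.

Lemma catalg_mulE a b x z (h : mor x z) :
  catalg_mul a b (arr h) = \sum_(y : ob C) \sum_(f : mor x y)
    \sum_(g : mor y z | fincat_comp g f == h) a (arr g) * b (arr f).
Proof. by rewrite ffunE. Qed.

Lemma sum_fiber (I J : finType) (p : I -> J) (P : pred J) (F : J -> I -> k) :
  \sum_(j | P j) \sum_(i | p i == j) F j i = \sum_(i | P (p i)) F (p i) i.
Proof.
rewrite (exchange_big_dep (fun i => P (p i))) /=; last by move=> j i Pj /eqP ->.
apply: eq_bigr => i Pi; rewrite (big_pred1 (p i)) // => j /=.
by rewrite [j == _]eq_sym; case: eqP => [<-|]; rewrite ?andbT ?andbF.
Qed.

Fact catalg_mulA : associative catalg_mul.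
Proof.
move=> a b c; apply: catalg_ext => x w h; rewrite !catalg_mulE.
transitivity (\sum_(z : ob C) \sum_(y : ob C) \sum_(f : mor x y)
    \sum_(g : mor y z) \sum_(e : mor z w | fincat_comp e (fincat_comp g f) == h)
      a (arr e) * (b (arr g) * c (arr f))).
  apply: eq_bigr => z _.
  transitivity (\sum_(d : mor x z) \sum_(y : ob C) \sum_(f : mor x y)
      \sum_(g : mor y z | fincat_comp g f == d) \sum_(e : mor z w | fincat_comp e d == h)
      a (arr e) * (b (arr g) * c (arr f))).
    apply: eq_bigr => d _.
    under eq_bigr => e _ do rewrite catalg_mulE big_distrr /=.
    rewrite exchange_big; apply: eq_bigr => y _.
    under eq_bigr => e _ do rewrite big_distrr /=.
    rewrite exchange_big; apply: eq_bigr => f _.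
    under eq_bigr => e _ do rewrite big_distrr /=.
    by rewrite exchange_big.
  rewrite exchange_big; apply: eq_bigr => y _.
  rewrite exchange_big; apply: eq_bigr => f _.
  exact: (sum_fiber _ _ (fun d g => \sum_(e : mor z w | fincat_comp e d == h) _)).
rewrite exchange_big; apply: eq_bigr => y _ /=.
rewrite exchange_big; apply: eq_bigr => f _ /=.
under [RHS]eq_bigr => d _ do rewrite catalg_mulE big_distrl /=.
rewrite [RHS]exchange_big; apply: eq_bigr => z _ /=.
under [RHS]eq_bigr => d _ do rewrite big_distrl /=.
rewrite [RHS]exchange_big; apply: eq_bigr => g _ /=.
under [RHS]eq_bigr => d _ do rewrite big_distrl /=.
rewrite (sum_fiber (fun e => fincat_comp e g) (fun d => fincat_comp d f == h)
  (fun _ e => a (arr e) * b (arr g) * c (arr f))).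
apply: eq_big => [e|e _]; first by rewrite /fincat_comp mcompA.
by rewrite mulrA.
Qed.

Fact catalg_mulDl : left_distributive catalg_mul +%R.
Proof.
move=> a b c; apply: catalg_ext => x z h; rewrite [RHS]ffunE !catalg_mulE.
rewrite -big_split; apply: eq_bigr => y _; rewrite -big_split.
apply: eq_bigr => f _; rewrite -big_split; apply: eq_bigr => g _.
by rewrite ffunE mulrDl.
Qed.

Fact catalg_mulDr : right_distributive catalg_mul +%R.
Proof.
move=> a b c; apply: catalg_ext => x z h; rewrite [RHS]ffunE !catalg_mulE.
rewrite -big_split; apply: eq_bigr => y _; rewrite -big_split.
apply: eq_bigr => f _; rewrite -big_split; apply: eq_bigr => g _.
by rewrite ffunE mulrDr.
Qed.

Lemma catalg_oneE x y (h : mor x y) :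
  catalg_one (arr h) = (arr h == arr (fincat_id x))%:R.
Proof.
rewrite sum_ffunE (bigD1 x) //= big1 ?addr0 ?ffunE // => u ux.
rewrite ffunE; case: eqP => // /(congr1 (fun m : arrow => (tag m).1)) /= e.
by rewrite e eqxx in ux.
Qed.

Fact catalg_mul1 : left_id catalg_one catalg_mul.
Proof.
move=> a; apply: catalg_ext => x z h; rewrite catalg_mulE.
rewrite (bigD1 z) //= [X in _ + X]big1 ?addr0 => [|y yz]; last first.
  rewrite big1 // => f _; rewrite big1 // => g _; rewrite catalg_oneE.
  case: eqP => [/(congr1 (fun m : arrow => (tag m).2)) /= e|]; last by rewrite mul0r.
  by rewrite e eqxx in yz.
transitivity (\sum_(f : mor x z) (f == h)%:R * a (arr f)); last first.
  rewrite (bigD1 h) //= eqxx mul1r big1 ?addr0 // => f /negPf ->.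
  by rewrite mul0r.
apply: eq_bigr => f _; rewrite big_mkcond (bigD1 (fincat_id z)) //=.
rewrite big1 ?addr0 => [|g gz].
  rewrite /fincat_comp /fincat_id mcomp1m catalg_oneE eqxx mul1r.
  by case: eqP; rewrite ?mul1r ?mul0r.
rewrite catalg_oneE (inj_eq (@arr_inj _ _)) (negPf gz) mul0r.
by case: ifP.
Qed.

Fact catalg_mulr1 : right_id catalg_one catalg_mul.
Proof.
move=> a; apply: catalg_ext => x z h; rewrite catalg_mulE.
rewrite (bigD1 x) //= [X in _ + X]big1 ?addr0 => [|y yx]; last first.
  rewrite big1 // => f _; rewrite big1 // => g _; rewrite catalg_oneE.
  case: eqP => [/(congr1 (fun m : arrow => (tag m).2)) /= e|]; last by rewrite mulr0.
  by rewrite e eqxx in yx.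
rewrite (bigD1 (fincat_id x)) //= [X in _ + X]big1 ?addr0 => [|f fx]; last first.
  rewrite big1 // => g _; rewrite catalg_oneE (inj_eq (@arr_inj _ _)).
  by rewrite (negPf fx) mulr0.
rewrite (big_pred1 h) => [|g /=]; last by rewrite /fincat_comp /fincat_id mcompm1.
by rewrite catalg_oneE eqxx mulr1.
Qed.

HB.instance Definition _ := GRing.Zmodule_isPzRing.Build catalg
  catalg_mulA catalg_mul1 catalg_mulr1 catalg_mulDl catalg_mulDr.

(* The multiplication table of the basis of morphisms. *)
Lemma catalg_basis_comp x y z (g : mor y z) (f : mor x y) :
  catalg_basis (arr g) * catalg_basis (arr f) = catalg_basis (arr (fincat_comp g f)).
Proof.
have srcP u v u' v' (h : mor u v) (h' : mor u' v') : arr h = arr h' -> u = u'.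
  by move/(congr1 (fun m : arrow => (tag m).1)).
have tgtP u v u' v' (h : mor u v) (h' : mor u' v') : arr h = arr h' -> v = v'.
  by move/(congr1 (fun m : arrow => (tag m).2)).
apply: catalg_ext => u w h; rewrite [LHS]catalg_mulE ffunE.
have [/andP[/eqP xu /eqP zw]|ne] := boolP ((x == u) && (z == w)); last first.
  rewrite big1 => [|v _]; last first.
    rewrite big1 // => f' _; rewrite big1 // => g' _; rewrite !ffunE.
    case: eqP => [/tgtP e|]; last by rewrite mul0r.
    case: eqP => [/srcP e'|]; last by rewrite mulr0.
    by rewrite e e' !eqxx in ne.
  case: eqP => // e.
  by rewrite -(srcP _ _ _ _ _ _ e) -(tgtP _ _ _ _ _ _ e) !eqxx in ne.
subst u w; rewrite (inj_eq (@arr_inj _ _)) (bigD1 y) //=.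
rewrite [X in _ + X]big1 ?addr0 => [|v vy]; last first.
  rewrite big1 // => f' _; rewrite big1 // => g' _; rewrite !ffunE.
  case: eqP => [/srcP e|]; last by rewrite mul0r.
  by rewrite e eqxx in vy.
rewrite (bigD1 f) //= [X in _ + X]big1 ?addr0 => [|f' ff]; last first.
  rewrite big1 // => g' _; rewrite !ffunE !(inj_eq (@arr_inj _ _)).
  by rewrite (negPf ff) mulr0.
rewrite big_mkcond (bigD1 g) //= [X in _ + X]big1 ?addr0 => [|g' gg]; last first.
  by rewrite !ffunE !(inj_eq (@arr_inj _ _)) (negPf gg) mul0r; case: ifP.
by rewrite !ffunE !eqxx mulr1 eq_sym; case: eqP.
Qed.

Lemma catalg_basis_notcomp x y y' z (g : mor y' z) (f : mor x y) :
  y != y' -> catalg_basis (arr g) * catalg_basis (arr f) = 0.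
Proof.
move=> yy'; apply: catalg_ext => u w h; rewrite [LHS]catalg_mulE ffunE.
rewrite big1 // => v _; rewrite big1 // => f' _; rewrite big1 // => g' _.
rewrite !ffunE; case: eqP => [/(congr1 (fun m : arrow => (tag m).1)) /= e|_];
  last by rewrite mul0r.
case: eqP => [/(congr1 (fun m : arrow => (tag m).2)) /= e'|_];
  last by rewrite mulr0.
by rewrite -e' -e eqxx in yy'.
Qed.

Lemma catalg_scalerAl (c : k) (a b : catalg) : c *: (a * b) = (c *: a) * b.
Proof.
apply: catalg_ext => x z h; rewrite [LHS]ffunE [in LHS]catalg_mulE [RHS]catalg_mulE.
rewrite scaler_sumr; apply: eq_bigr => y _; rewrite scaler_sumr.
apply: eq_bigr => f _; rewrite scaler_sumr; apply: eq_bigr => g _.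
by rewrite ffunE scalerAl.
Qed.

Lemma catalg_scalerAr (c : k) (a b : catalg) : c *: (a * b) = a * (c *: b).
Proof.
apply: catalg_ext => x z h; rewrite [LHS]ffunE [in LHS]catalg_mulE [RHS]catalg_mulE.
rewrite scaler_sumr; apply: eq_bigr => y _; rewrite scaler_sumr.
apply: eq_bigr => f _; rewrite scaler_sumr; apply: eq_bigr => g _.
by rewrite ffunE scalerAr.
Qed.

End CategoryAlgebra.

(** * Hereditary rings *)

Definition projective (A : pzRingType) (P : lmodType A) : Prop :=
  forall (M N : lmodType A) (p : {linear M -> N}) (u : {linear P -> N}),
    (forall y, exists x, p x = y) ->
    exists v : {linear P -> M}, forall x, p (v x) = u x.

(* Left hereditary: submodules of projective left modules are projective.
   Submodules are given by injective linear maps. Left and right hereditary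
   coincide for finite-dimensional algebras. *)
Definition hereditary (A : pzRingType) : Prop :=
  forall (P S : lmodType A) (i : {linear S -> P}),
    injective i -> projective P -> projective S.

(* Main.v *)
(** A nonendomorphism of a skeletal finite EI category is irreducible if it is not
    a composite of two nonendomorphisms; the category is free exactly when every
    morphism factors into irreducibles uniquely up to automorphisms.

    Suppose that the algebra A is hereditary. If the order of G = End(x) were 0
    in k, the sum s of G would be square-zero; but A -> A s splits, and the image
    of s is a left-invariant y with y s = s, which forces |G| y(1) = 1. Next, the
    left ideal J spanned by the nonendomorphisms out of x is projective, so it
    splits off the module F of classes [m, f] of composable pairs with f : x -> y
    irreducible, modulo [m g, f] = [m, g f]. The complement of J in F lies in
    rad(A) F, hence vanishes, so m f determines [m, f]: this is unique
    factorization.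

    Conversely let S embed in a projective P, and lift u : S -> N along M -> N.
    Averaging over the endomorphism groups gives a k-linear lift v0 of u, and a
    k-linear retraction r of P onto S, that commute with endomorphisms. The defect
    m |-> v0 m - m v0 is a cocycle on S; precomposed with r on irreducibles, it
    extends by freeness to a cocycle on P, which twists the module M + P. The
    twisted module projects onto P, and a section of the projection provides the
    correction making v0 linear over A. *)

From HB Require Import structures.
Require Import Defs.
Set Warnings "-notation-overridden,-ambiguous-paths,-redundant-canonical-projection,-projection-no-head-constant".
From mathcomp Require Import boolp classical_sets.
From mathcomp Require Import all_boot all_order all_algebra all_fingroup.

Set Implicit Arguments.
Unset Strict Implicit.
Unset Printing Implicit Defensive.

Import GRing.Theory.
Local Open Scope ring_scope.

Section LinearFun.

Variables (R : pzRingType) (U V : lmodType R) (f : U -> V).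

(** The proof of linearity is an argument so that the linear structure can be attached to the term
    [linear_fun lf], whatever the function is. *)
Definition linear_fun (_ : linear f) : U -> V := f.

HB.instance Definition _ (lf : linear f) :=
  GRing.isLinear.Build R U V *:%R (linear_fun lf) lf.

End LinearFun.

(** * Modules over the category algebra *)

Section Modules.

Variables (k : fieldType) (C : fincat).

Local Notation A := (catalg k C).

Lemma catalg_decomp (a : A) : a = \sum_m a m *: catalg_basis k m.
Proof.
apply/ffunP => m; rewrite sum_ffunE (bigD1 m) //= big1 ?addr0.
  by rewrite 2!ffunE eqxx [RHS]mulr1.
by move=> n nm; rewrite 2!ffunE eq_sym (negPf nm) [LHS]mulr0.
Qed.

Lemma catalg_basis_id : \sum_(x : ob C) catalg_basis k (arr (fincat_id x)) = 1.
Proof. by []. Qed.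

(** * Linear extension from a basis *)

Section Linearize.

Variables (I : finType) (V : lmodType k).

Definition lin_ext (g : I -> V) (a : {ffun I -> k^o}) : V := \sum_i a i *: g i.

Lemma lin_ext_is_linear g : linear (lin_ext g).
Proof.
move=> c a b; rewrite scaler_sumr -big_split; apply: eq_bigr => i _.
by rewrite !ffunE scalerDl scalerA.
Qed.

HB.instance Definition _ g :=
  GRing.isLinear.Build k {ffun I -> k^o} V *:%R (lin_ext g) (lin_ext_is_linear g).

Definition delta (i : I) : {ffun I -> k^o} := [ffun j => (j == i)%:R].

Lemma lin_ext_delta g i : lin_ext g (delta i) = g i.
Proof.
rewrite /lin_ext (bigD1 i) //= big1 ?addr0 ?ffunE ?eqxx ?scale1r // => j ji.
by rewrite ffunE (negPf ji) scale0r.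
Qed.

Lemma delta_decomp (a : {ffun I -> k^o}) : a = \sum_i a i *: delta i.
Proof.
apply/ffunP => i; rewrite sum_ffunE (bigD1 i) //= big1 ?addr0.
  by rewrite 2!ffunE eqxx [RHS]mulr1.
by move=> n nm; rewrite 2!ffunE eq_sym (negPf nm) [LHS]mulr0.
Qed.

Lemma delta_ext (u u' : {linear {ffun I -> k^o} -> V}) :
  (forall i, u (delta i) = u' (delta i)) -> u =1 u'.
Proof.
move=> e a; rewrite (delta_decomp a) !linear_sum; apply: eq_bigr => i _.
by rewrite !linearZ e.
Qed.

End Linearize.

Lemma delta_inj I : injective (@delta I).
Proof.
move=> i j /ffunP/(_ i); rewrite !ffunE eqxx; case: eqP => // _ /eqP.
by rewrite oner_eq0.
Qed.

(** A representation of [C] spread over one [k]-space: the last two laws make the identities act as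
    orthogonal idempotents with sum 1, so [V] is the direct sum of its components at the objects. *)
Record crep (V : lmodType k) := CRep {
  crep_act : arrow C -> V -> V;
  crep_linear : forall m, linear (crep_act m);
  crep_comp : forall x y z (g : mor y z) (f : mor x y) v,
    crep_act (arr g) (crep_act (arr f) v) = crep_act (arr (fincat_comp g f)) v;
  crep_notcomp : forall x y y' z (g : mor y' z) (f : mor x y) v,
    y != y' -> crep_act (arr g) (crep_act (arr f) v) = 0;
  crep_id : forall v, \sum_x crep_act (arr (fincat_id x)) v = v
}.

(** A copy of [V] whose scalars are the elements of the category algebra, while [V] itself keeps its
    scalars in [k]. *)
Definition repmod (V : lmodType k) (r : crep V) : Type := V.

Section RepMod.

Variables (V : lmodType k) (r : crep V).

Local Notation act := (crep_act r).

HB.instance Definition _ m :=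
  GRing.isLinear.Build k V V *:%R (act m) (crep_linear r m).

HB.instance Definition _ := GRing.Zmodule.copy (repmod r) V.

Let scale (a : A) (v : V) : V := lin_ext (act^~ v) a.

Let scale_basis m v : scale (catalg_basis k m) v = act m v.
Proof. exact: lin_ext_delta. Qed.

Let scaleDr a : {morph scale a : u v / u + v}.
Proof.
by move=> u v; rewrite -big_split; apply: eq_bigr => m _; rewrite linearD scalerDr.
Qed.

Let scaleZr a c v : scale a (c *: v) = c *: scale a v.
Proof.
rewrite /scale /lin_ext scaler_sumr; apply: eq_bigr => m _.
by rewrite linearZ !scalerA mulrC.
Qed.

Let scaleA a b v : scale a (scale b v) = scale (a * b) v.
Proof.
have basisA m n : scale (catalg_basis k m) (scale (catalg_basis k n) v) =
    scale (catalg_basis k m * catalg_basis k n) v.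
  rewrite !scale_basis; case: m n => [[y' z] g] [[x y] f] /=.
  have [e|ne] := eqVneq y y'.
    subst y'; rewrite [catalg_basis k _ * _](catalg_basis_comp k g f) scale_basis.
    exact: (crep_comp r g f).
  rewrite [catalg_basis k _ * _](catalg_basis_notcomp k g f ne) /scale linear0.
  exact: (crep_notcomp r g f).
have basisAl m : scale (catalg_basis k m) (scale b v) =
    scale (catalg_basis k m * b) v.
  rewrite [b in RHS]catalg_decomp mulr_sumr /scale linear_sum /=.
  rewrite [lin_ext _ b]/lin_ext !lin_ext_delta linear_sum /=.
  apply: eq_bigr => n _; rewrite linearZ -catalg_scalerAr linearZ /=.
  by have := basisA m n; rewrite !scale_basis => ->.
rewrite [a in RHS]catalg_decomp mulr_suml /scale linear_sum /=.
apply: eq_bigr => m _; rewrite -catalg_scalerAl linearZ /=; congr (_ *: _).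
exact: etrans (esym (scale_basis _ _)) (basisAl m).
Qed.

Let scale1 v : scale 1 v = v.
Proof.
rewrite -catalg_basis_id /scale linear_sum /= -[RHS](crep_id r).
by apply: eq_bigr => x _; rewrite lin_ext_delta.
Qed.

Let scaleDl v : {morph scale^~ v : a b / a + b}.
Proof. by move=> a b; rewrite /scale linearD. Qed.

HB.instance Definition _ :=
  GRing.Zmodule_isLmodule.Build A (repmod r) scaleA scale1 scaleDr scaleDl.

Lemma repmodE (a : A) (v : repmod r) : a *: v = lin_ext (act^~ (v : V)) a.
Proof. by []. Qed.

Lemma repmod_basis m (v : repmod r) : catalg_basis k m *: v = act m v.
Proof. exact: scale_basis. Qed.

End RepMod.

(** The image of [c] in the centre of the category algebra; restriction of scalars goes along this
    map. *)
Definition alg_scalar (c : k) : A := c *: (1 : A).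

Lemma alg_scalarE c (a : A) : alg_scalar c * a = c *: a.
Proof. by rewrite /alg_scalar -catalg_scalerAl mul1r. Qed.

Lemma alg_scalarC c (a : A) : a * alg_scalar c = alg_scalar c * a.
Proof. by rewrite alg_scalarE /alg_scalar -catalg_scalerAr mulr1. Qed.

Lemma repmod_scalar (V : lmodType k) (r : crep V) (c : k) (v : repmod r) :
  alg_scalar c *: v = c *: (v : V) :> V.
Proof. by rewrite repmodE /alg_scalar linearZ /= -repmodE scale1r. Qed.

(** * Restriction of scalars to [k] *)

Definition restr (M : lmodType A) : Type := M.

Section Restriction.

Variable M : lmodType A.

HB.instance Definition _ := GRing.Zmodule.copy (restr M) M.

Let scale (c : k) (v : M) : M := alg_scalar c *: v.

Let scaleA a b v : scale a (scale b v) = scale (a * b) v.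
Proof. by rewrite /scale scalerA alg_scalarE /alg_scalar scalerA. Qed.

Let scale1 v : scale 1 v = v.
Proof. by rewrite /scale /alg_scalar !scale1r. Qed.

Let scaleDr : right_distributive scale +%R.
Proof. by move=> c u v; rewrite /scale scalerDr. Qed.

Let scaleDl v : {morph scale^~ v : a b / a + b}.
Proof. by move=> a b; rewrite /scale /alg_scalar !scalerDl. Qed.

HB.instance Definition _ :=
  GRing.Zmodule_isLmodule.Build k (restr M) scaleA scale1 scaleDr scaleDl.

Lemma restrE (c : k) (v : restr M) : c *: v = alg_scalar c *: (v : M) :> M.
Proof. by []. Qed.

Definition mact (m : arrow C) (v : restr M) : restr M := catalg_basis k m *: (v : M).

Lemma mact_is_linear m : linear (mact m).
Proof.
by move=> c u v; rewrite /mact scalerDr !restrE !scalerA alg_scalarC.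
Qed.

HB.instance Definition _ m :=
  GRing.isLinear.Build k (restr M) (restr M) *:%R (mact m) (mact_is_linear m).

Lemma mactE (a : A) (v : M) : a *: v = \sum_m a m *: mact m v :> restr M.
Proof.
rewrite [a in LHS]catalg_decomp scaler_suml; apply: eq_bigr => m _.
by rewrite restrE /mact !scalerA alg_scalarE.
Qed.

Lemma mact_comp x y z (g : mor y z) (f : mor x y) v :
  mact (arr g) (mact (arr f) v) = mact (arr (fincat_comp g f)) v.
Proof. by rewrite /mact scalerA catalg_basis_comp. Qed.

Lemma mact_notcomp x y y' z (g : mor y' z) (f : mor x y) v :
  y != y' -> mact (arr g) (mact (arr f) v) = 0.
Proof. by move=> ne; rewrite /mact scalerA catalg_basis_notcomp // scale0r. Qed.

Lemma mact_id v : \sum_x mact (arr (fincat_id x)) v = v.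
Proof.
apply: etrans (esym (scaler_suml (v : M) _ _ _)) _.
by rewrite catalg_basis_id scale1r.
Qed.

End Restriction.

Lemma restr_linear (M N : lmodType A) (u : {linear M -> N}) :
  linear (u : restr M -> restr N).
Proof. by move=> c x y; rewrite !restrE linearP. Qed.

Lemma mact_linear (M N : lmodType A) (u : {linear M -> N}) m (v : restr M) :
  u (mact m v) = mact m (u v : restr N).
Proof. by rewrite /mact linearZ. Qed.

(** The morphisms span the algebra over [k], so linearity over the algebra can be tested on them. *)
Lemma mact_linearI (M N : lmodType A) (u : M -> N) :
  linear (u : restr M -> restr N) ->
  (forall m (v : restr M), u (mact m v) = mact m (u v : restr N)) -> linear u.
Proof.
move=> ul um.
pose u' : {linear restr M -> restr N} := linear_fun ul.
move=> a x y; apply: etrans (raddfD u' _ _) _; congr (_ + _).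
apply: etrans (esym (mactE a (u x))).
apply: etrans (congr1 u' (mactE a x)) _; rewrite linear_sum.
by apply: eq_bigr => m _; rewrite linearZ; congr (_ *: _); apply: um.
Qed.

End Modules.

(** * Linear selections *)

Section LinearSelection.

Variables (k : fieldType) (X Y : lmodType k).

Local Notation XY := (X * Y)%type.

Implicit Types (G W : set XY).

Definition linear_rel G : Prop :=
  G 0 /\ forall (c : k) p q, G p -> G q -> G (c *: p + q).

(** The graph, inside [W], of a linear map on a subspace of [X]: a linear relation is single-valued
    as soon as its fibre over 0 is trivial. *)
Definition partial_selection W G : Prop :=
  [/\ linear_rel G, (forall p, G p -> W p) & forall y, G (0, y) -> y = 0].

Lemma linear_relB G p q : linear_rel G -> G p -> G q -> G (p - q).
Proof. by case=> _ GL Gp Gq; have := GL (-1) q p Gq Gp; rewrite scaleN1r addrC. Qed.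

(* Zorn's lemma on graphs of partial selections; [P] speaks of [G `|` G0] because
   [Zorn_bigcup] also asks for the union of the empty chain. *)
Lemma linear_selection W G0 :
  linear_rel W -> (forall x, exists y, W (x, y)) -> partial_selection W G0 ->
  exists f : {linear X -> Y}, (forall x, W (x, f x)) /\ forall x y, G0 (x, y) -> f x = y.
Proof.
move=> [W0 WL] Wtot G0sel.
pose P G := partial_selection W (G `|` G0)%classic.
have [|A [[[A0 AL] AW Afun] Amax]] := @Zorn_bigcup XY P.
  move=> F FP Ftot.
  have pick2 p q : ((\bigcup_(G in F) G) `|` G0)%classic p ->
      ((\bigcup_(G in F) G) `|` G0)%classic q ->
      (G0 p /\ G0 q) \/ exists2 G, F G & (G `|` G0)%classic p /\ (G `|` G0)%classic q.
    move=> [[G FG Gp]|p0] [[G' FG' Gq]|q0].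
    - by have [s|s] := Ftot G G' FG FG'; right; [exists G'|exists G] => //; split; left; auto.
    - by right; exists G => //; split; [left|right].
    - by right; exists G' => //; split; [right|left].
    - by left.
  have up G p : F G -> (G `|` G0)%classic p -> ((\bigcup_(G in F) G) `|` G0)%classic p.
    by move=> FG [Gp|]; [left; exists G|right].
  have [[G00 G0L] G0W G0fun] := G0sel.
  split; first split.
  - by right.
  - move=> c p q Up Uq; have [[p0 q0]|[G FG [Gp Gq]]] := pick2 p q Up Uq.
      by right; apply: G0L.
    by apply: (up G) => //; have [[_ GL] _ _] := FP G FG; apply: GL.
  - move=> p Up; have [[p0 _]|[G FG [Gp _]]] := pick2 p p Up Up; first exact: G0W.
    by have [_ GW _] := FP G FG; apply: GW.
  - move=> y Uy; have [[y0 _]|[G FG [Gy _]]] := pick2 _ _ Uy Uy; first exact: G0fun.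
    by have [_ _ Gfun] := FP G FG; apply: Gfun.
pose G := (A `|` G0)%classic.
have Gtot x : exists y, G (x, y).
  apply: contrapT => nx; have [y Wxy] := Wtot x.
  (* If [x] is outside the domain of [G], adjoining the line of [(x, y)] gives a larger partial
     selection, against the maximality of [A]. *)
  pose B : set XY := fun p => exists c q, G q /\ p = c *: (x, y) + q.
  have GB q : G q -> B q by move=> Gq; exists 0, q; rewrite scale0r add0r.
  have BE : (B `|` G0)%classic = B.
    by apply/seteqP; split=> p; [case=> // p0; apply: GB; right|left].
  apply: (Amax B).
    split=> [p Ap|BA]; first by apply: GB; left.
    apply: nx; exists y; left; apply: BA; exists 1, 0; split; first exact: A0.
    by rewrite scale1r addr0.
  rewrite /P BE; split; first split.
  - by apply: GB; apply: A0.
  - move=> c _ _ [a [p [Gp ->]]] [b [q [Gq ->]]]; exists (c * a + b), (c *: p + q).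
    by split; [exact: AL|rewrite scalerDr scalerA scalerDl addrACA].
  - by move=> _ [c [q [Gq ->]]]; apply: WL => //; apply: AW.
  move=> z [c [[q1 q2] [Gq [e1 e2]]]].
  have [c0|c0] := eqVneq c 0.
    rewrite c0 !scale0r !add0r in e1 e2; subst z; apply: Afun; rewrite e1; exact: Gq.
  (* For [c] nonzero, solving [c *: x + q1 = 0] for [x] puts [x] in the domain of [G] after all. *)
  case: nx; exists (- c^-1 *: q2).
  have <- : - c^-1 *: q1 = x.
    move/esym/eqP: e1; rewrite addr_eq0 => /eqP e1.
    by rewrite scaleNr -scalerN -e1 scalerA mulVf // scale1r.
  have := AL (- c^-1) (q1, q2) 0 Gq A0; rewrite addr0; exact.
have Gu x y y' : G (x, y) -> G (x, y') -> y = y'.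
  move=> Gy Gy'; apply/subr0_eq/Afun.
  have -> : (0, y - y') = (x, y) - (x, y') :> XY by rewrite -[RHS]/(x - x, y - y') subrr.
  exact: (linear_relB (conj A0 AL) Gy Gy').
pose f x := sval (cid (Gtot x)).
have fG x : G (x, f x) by rewrite /f; case: cid.
have fl : linear f.
  move=> c x x'; apply: (Gu _ _ _ (fG _)).
  by apply: (AL c (x, f x) (x', f x')); apply: fG.
exists (linear_fun fl); split=> [x|x y xy]; first exact: AW (fG x).
by apply: (Gu _ _ _ (fG x)); right.
Qed.

End LinearSelection.

(** A selection that extends the inverse of [i] on its image; injectivity of [i] makes this inverse
    single-valued. *)
Lemma linear_retraction (k : fieldType) (X Y : lmodType k) (i : X -> Y) :
  linear i -> injective i -> exists r : {linear Y -> X}, cancel i r.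
Proof.
move=> li ii; pose i' := linear_fun li.
have [|x||r [_ rP]] := @linear_selection k Y X (fun=> True) (fun p => p.1 = i p.2).
- by split.
- by exists 0.
- split=> [|//|y /= /esym e]; last by apply: ii; rewrite e; exact: esym (linear0 i').
  split=> [|c p q pP qP]; first exact: esym (linear0 i').
  by rewrite /= pP qP; exact: esym (linearP i' c p.2 q.2).
by exists r => x; apply: rP.
Qed.

(** A selection inside the fibre product of [u] and [p], started from the zero relation. *)
Lemma linear_lifting (k : fieldType) (X Y Z : lmodType k) (p : Y -> Z) (u : X -> Z) :
  linear p -> linear u -> (forall z, exists y, p y = z) ->
  exists v : {linear X -> Y}, forall x, p (v x) = u x.
Proof.
move=> lp lu sp; pose p' := linear_fun lp; pose u' := linear_fun lu.
have [|x||v [vP _]] := @linear_selection k X Y (fun q => p q.2 = u q.1) (fun q => q = 0).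
- split=> [|c q r qP rP]; first exact: etrans (linear0 p') (esym (linear0 u')).
  apply: etrans (linearP p' c q.2 r.2) _.
  apply: etrans (congr2 (fun a b => c *: a + b) qP rP) _.
  exact: esym (linearP u' c q.1 r.1).
- by have [y e] := sp (u x); exists y.
- split=> [|_ ->|y [] //]; last exact: etrans (linear0 p') (esym (linear0 u')).
  by split=> // c _ _ -> ->; rewrite scaler0 addr0.
by exists v.
Qed.

(** * Submodules as modules *)

Section Submodules.

Variables (R : pzRingType) (V : lmodType R) (I : {pred V}).

(** As with [linear_fun], the term carries the proof of closure, from which the submodule structure
    is inferred. *)
Definition sub_pred (_ : submod_closed I) : {pred V} := I.

Variable HI : submod_closed I.

HB.instance Definition _ := GRing.isSubmodClosed.Build R V (sub_pred HI) HI.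

Record submod := Submod { submod_val : V; _ : submod_val \in sub_pred HI }.

HB.instance Definition _ := [isSub for submod_val].
HB.instance Definition _ := [Choice of submod by <:].
HB.instance Definition _ := [SubChoice_isSubLmodule of submod by <:].

End Submodules.

(** * Left ideals of hereditary rings *)

Section LeftIdeals.

Variable R : pzRingType.

(** [R^o] is free on 1: a preimage of [u 1] determines a lift. *)
Lemma regular_projective : projective R^o.
Proof.
move=> M N p u ps; have [x px] := ps (u 1).
have lx : linear (fun a : R^o => a *: x : M) by move=> c a b; rewrite scalerDl scalerA.
exists (linear_fun lx) => a /=.
by rewrite linearZ px -linearZ /= [a *: _]mulr1.
Qed.

Lemma hereditary_left_ideal (I : {pred R^o}) (HI : submod_closed I) :
  hereditary R -> projective (submod HI).
Proof.
move=> hR; apply: (hR R^o (submod HI) (val : {linear submod HI -> R^o})).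
  exact: val_inj.
exact: regular_projective.
Qed.

End LeftIdeals.

Local Notation "g \oc f" := (fincat_comp g f) (at level 50, left associativity).

(** * Irreducible morphisms of EI categories *)

Section EICategories.

Variable C : fincat.

Lemma fcompA x y z w (h : mor z w) (g : mor y z) (f : mor x y) :
  h \oc (g \oc f) = h \oc g \oc f :> mor (f := C) x w.
Proof. exact: mcompA. Qed.

Lemma fcomp1m x y (f : mor (f := C) x y) : fincat_id y \oc f = f.
Proof. exact: mcomp1m. Qed.

Lemma fcompm1 x y (f : mor (f := C) x y) : f \oc fincat_id x = f.
Proof. exact: mcompm1. Qed.

Hypothesis hEI : EI C.

(** In an EI category the default [f] is never reached, by [endo_invP]. *)
Definition endo_inv (x : ob C) (f : mor x x) : mor x x :=
  odflt f [pick g | (g \oc f == fincat_id x) && (f \oc g == fincat_id x)].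

Lemma endo_invP (x : ob C) (f : mor x x) :
  endo_inv f \oc f = fincat_id x /\ f \oc endo_inv f = fincat_id x.
Proof.
rewrite /endo_inv; case: pickP => [g /andP[/eqP-> /eqP->] //|no].
have [g [gf fg]] := hEI f; have := no g.
by rewrite [_ \oc _]gf [_ \oc g]fg !eqxx.
Qed.

Lemma endo_invVm (x : ob C) : left_inverse (fincat_id x) (@endo_inv x) (@fincat_comp C x x x).
Proof. by move=> f; case: (endo_invP f). Qed.

Lemma endo_invmV x y (f : mor x x) (g : mor (f := C) x y) :
  g \oc f \oc endo_inv f = g.
Proof. by rewrite -fcompA (endo_invP f).2 fcompm1. Qed.

(** Indexed by the proof of [EI C], so that the group structure resting on this proof can be
    attached to the type. *)
Definition endo (h : EI C) (x : ob C) : Type := mor x x.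

HB.instance Definition _ x := Finite.on (endo hEI x).

HB.instance Definition _ x := Finite_isGroup.Build (endo hEI x)
  (fun f g h => fcompA f g h) (fun f => fcomp1m f) (@endo_invVm x).

Definition mor_biset (x y : ob C) : biset (endo hEI y) (endo hEI x) :=
  @Biset (endo hEI y) (endo hEI x) (mor x y)
    (fun g f => g \oc f) (fun f g => f \oc g)
    (fun f => fcomp1m f) (fun g h f => esym (fcompA g h f))
    (fun f => fcompm1 f) (fun f g h => fcompA f g h) (fun g f h => fcompA g f h).

(** A factor is an endomorphism exactly when the middle object is the corresponding end of [f], so
    the condition can be put on [z]. *)
Definition irr (x y : ob C) (f : mor x y) : bool :=
  (x != y) && [forall z, forall g : mor z y, forall h : mor x z,
    (g \oc h == f) ==> (z == x) || (z == y)].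

Lemma irrP (x y : ob C) (f : mor x y) :
  reflect (x != y /\ forall z (g : mor z y) (h : mor x z), g \oc h = f ->
             (z == x) || (z == y)) (irr f).
Proof.
apply: (iffP andP) => -[ne fP]; split=> //.
  by move=> z g h e; have /forallP/(_ g)/forallP/(_ h)/implyP := forallP fP z;
    apply; apply/eqP.
by apply/forallP=> z; apply/forallP=> g; apply/forallP=> h; apply/implyP=> /eqP/fP.
Qed.

Lemma irr_compl (x y : ob C) (g : mor y y) (f : mor x y) : irr f -> irr (g \oc f).
Proof.
case/irrP=> ne fP; apply/irrP; split=> // z u v e.
by apply: (fP z (endo_inv g \oc u) v); rewrite -fcompA e fcompA endo_invVm fcomp1m.
Qed.

Lemma irr_compr (x y : ob C) (g : mor x x) (f : mor x y) : irr f -> irr (f \oc g).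
Proof.
case/irrP=> ne fP; apply/irrP; split=> // z u v e.
by apply: (fP z u (v \oc endo_inv g)); rewrite fcompA e endo_invmV.
Qed.

Definition irr_mor (x y : ob C) : finType := {f : mor x y | irr f}.

Definition irr_lact (x y : ob C) (g : endo hEI y) (f : irr_mor x y) : irr_mor x y :=
  Sub (g \oc val f) (irr_compl g (valP f)).

Definition irr_ract (x y : ob C) (f : irr_mor x y) (g : endo hEI x) : irr_mor x y :=
  Sub (val f \oc g) (irr_compr g (valP f)).

Definition irr_biset (x y : ob C) : biset (endo hEI y) (endo hEI x).
Proof.
apply: (@Biset _ _ (irr_mor x y) (@irr_lact x y) (@irr_ract x y)) => *;
  apply: val_inj; rewrite /= ?fcompA //; [exact: fcomp1m|exact: fcompm1].
Defined.

Hypothesis hsk : skeletal C.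

(** Both composites are automorphisms, so [f] has a left inverse [l] and a right inverse [r]; these
    agree, and [f] is an isomorphism. *)
Lemma EI_antisym (x y : ob C) (f : mor x y) (g : mor y x) : x = y.
Proof.
apply: hsk; have [lf _] := endo_invP (g \oc f); have [_ fr] := endo_invP (f \oc g).
set l := endo_inv (g \oc f) \oc g; set r := g \oc endo_inv (f \oc g).
have lr : l = r by rewrite -[l]fcompm1 -fr -[f \oc g \oc _]fcompA fcompA
  -[l \oc f]fcompA lf fcomp1m.
by exists f, l; split; [rewrite -[LHS]fcompA | rewrite lr [LHS]fcompA].
Qed.

(** A measure that rises strictly along nonendomorphisms ([rank_lt]); the later inductions on
    factorizations run on it. *)
Definition rank (y : ob C) : nat := #|[set u : ob C | (0 < #|mor u y|)%N]|.

(** Composing with [f] turns the predecessors of [x] into predecessors of [y]; [y] precedes itself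
    but, by [EI_antisym], not [x]. *)
Lemma rank_lt (x y : ob C) (f : mor x y) : x != y -> (rank x < rank y)%N.
Proof.
move=> ne; apply: proper_card; apply/properP; split.
  apply/subsetP=> u; rewrite !inE => /card_gt0P[g _].
  by apply/card_gt0P; exists (f \oc g).
exists y; rewrite !inE; first by apply/card_gt0P; exists (fincat_id y).
by apply/negP=> /card_gt0P[g _]; rewrite (EI_antisym f g) eqxx in ne.
Qed.

Lemma irr_comp_tgt (x y z : ob C) (g : mor y z) (f : mor x y) :
  irr (g \oc f) -> x != y -> y = z.
Proof.
by case/irrP=> _ /(_ y g f erefl); rewrite eq_sym => /orP[->//|/eqP->].
Qed.

Lemma irr_comp_src (x y z : ob C) (g : mor y z) (f : mor x y) :
  irr (g \oc f) -> y != z -> x = y.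
Proof.
by case/irrP=> _ /(_ y g f erefl) /orP[/eqP->//|->].
Qed.

(** As long as [f] is reducible, its right factor has a target of smaller rank, so the splitting
    ends at an irreducible. *)
Lemma first_irr (x y : ob C) (f : mor x y) : x != y ->
  exists z (g : mor z y) (h : mor x z), irr h /\ f = g \oc h.
Proof.
have [n] := ubnP (rank y); elim: n y f => // n IH y f; rewrite ltnS => fn ne.
have [fi|] := boolP (irr f); first by exists y, (fincat_id y), f; rewrite fcomp1m.
rewrite negb_and ne /= => /forallPn[z /forallPn[g /forallPn[h]]].
rewrite negb_imply negb_or => /and3P[/eqP <- zx zy].
have [|z' [g' [h' [h'i ->]]]] := IH z h _ ltac:(by rewrite eq_sym).
  exact: leq_trans (rank_lt g zy) fn.
by exists z', (g \oc g'), h'; rewrite fcompA.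
Qed.

End EICategories.

(** * Unique factorization *)

Section FactorizationModule.

Variables (k : fieldType) (C : fincat) (hEI : EI C) (x : ob C).

Local Notation A := (catalg k C).

(** In [p = (y, z)], [y] is the middle object and [z] the target of a class [[m, f]]. *)
Definition fact (p : ob C * ob C) : finType :=
  bprod (mor_biset hEI p.1 p.2) (irr_biset hEI x p.1).

Definition facts : finType := {p : ob C * ob C & fact p}.

Definition fact_cls (y z : ob C) (m : mor y z) (f : irr_mor x y) : facts :=
  Tagged fact (i := (y, z)) (bcls (X := mor_biset hEI y z) (Y := irr_biset hEI x y) m f).

Lemma fact_clsP (b : facts) : exists y z (m : mor y z) f, b = fact_cls m f.
Proof. by case: b => [[y z] q] /=; have [m [f ->]] := bprodP q; exists y, z, m, f. Qed.

Lemma fact_cls_bal (y z : ob C) (m : mor y z) (g : mor y y) (f : irr_mor x y) :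
  fact_cls (m \oc g) f = fact_cls m (irr_lact (hEI := hEI) g f).
Proof. by congr (Tagged _ _); exact: (@bcls_eq _ _ _ (mor_biset hEI y z)). Qed.

(** The relation defining the biset product is already an equivalence, so equal classes differ by a
    single automorphism of the middle object. *)
Lemma fact_cls_inj (y y' z : ob C) (m : mor y z) (m' : mor y' z) f f' :
  fact_cls m f = fact_cls m' f' ->
  exists g : mor y y', y = y' /\ m = m' \oc g /\ g \oc val f = val f'.
Proof.
move=> e; have yy : y = y' by have := congr1 (fun b : facts => (tag b).1) e.
subst y'; have := eq_from_Tagged e => /eqmodP/existsP[g /andP[/eqP/= em /eqP/= ef]].
by exists g; rewrite ef.
Qed.

Definition fact_val (p : ob C * ob C) (q : fact p) : mor x p.2 :=
  (brep q).1 \oc val (brep q).2.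

Lemma fact_valE (y z : ob C) (m : mor y z) f : fact_val (tagged (fact_cls m f)) = m \oc val f.
Proof.
apply: (bprod_factor (X := mor_biset hEI y z) (Y := irr_biset hEI x y)
  (F := fun m f => m \oc val f)) => {}m g {}f /=.
by rewrite fcompA.
Qed.

Definition fact_post (y z w : ob C) (h : mor z w) (q : fact (y, z)) : fact (y, w) :=
  bcls (X := mor_biset hEI y w) (Y := irr_biset hEI x y) (h \oc (brep q).1) (brep q).2.

Lemma fact_postE (y z w : ob C) (h : mor z w) (m : mor y z) f :
  Tagged fact (i := (y, w)) (fact_post h (tagged (fact_cls m f))) = fact_cls (h \oc m) f.
Proof.
congr (Tagged _ _).
apply: (bprod_factor (X := mor_biset hEI y z) (Y := irr_biset hEI x y)
  (F := fun m f => bcls (X := mor_biset hEI y w) (Y := irr_biset hEI x y) (h \oc m) f))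
  => {}m g {}f /=.
rewrite fcompA.
exact: (@bcls_eq _ _ _ (mor_biset hEI y w) (irr_biset hEI x y)).
Qed.

Local Notation F0 := {ffun facts -> k^o}.

(** The sum has one term if the source of [h] is the target of [b], and none otherwise; this avoids
    a transport along an equation between objects. *)
Definition fact_act (h : arrow C) (b : facts) : F0 :=
  \sum_(h' : mor (tag b).2 (tag h).2 | arr h' == h)
    delta k (Tagged fact (i := ((tag b).1, (tag h).2))
       (fact_post h' (tagged b : fact ((tag b).1, (tag b).2)))).

Lemma fact_actE (y z w : ob C) (h : mor z w) (m : mor y z) f :
  fact_act (arr h) (fact_cls m f) = delta k (fact_cls (h \oc m) f).
Proof.
rewrite /fact_act (big_pred1 h) => [|h' /=]; last by rewrite (inj_eq (@arr_inj C _ _)).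
by rewrite fact_postE.
Qed.

Lemma fact_act0 (u y z w : ob C) (h : mor u w) (m : mor y z) f :
  z != u -> fact_act (arr h) (fact_cls m f) = 0.
Proof.
move=> ne; rewrite /fact_act big1 // => h' /eqP e.
have := congr1 (fun m : arrow C => (tag m).1) e => /= zu.
by rewrite zu eqxx in ne.
Qed.

Lemma fact_act_comp x' y' z' (g : mor y' z') (f : mor x' y') v :
  lin_ext (fact_act (arr g)) (lin_ext (fact_act (arr f)) v) = lin_ext (fact_act (arr (g \oc f))) v.
Proof.
apply: (delta_ext (u := lin_ext (fact_act (arr g)) \o lin_ext (fact_act (arr f)))) => b /=.
rewrite !lin_ext_delta; have [y [z [m [h ->]]]] := fact_clsP b.
have [e|ne] := eqVneq z x'; last by rewrite !fact_act0 // linear0.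
by case: _ / e f => f; rewrite !fact_actE lin_ext_delta fact_actE fcompA.
Qed.

Lemma fact_act_notcomp x' y1 y2 z' (g : mor y2 z') (f : mor x' y1) v :
  y1 != y2 -> lin_ext (fact_act (arr g)) (lin_ext (fact_act (arr f)) v) = 0.
Proof.
move=> ne; apply: (delta_ext (u := lin_ext (fact_act (arr g)) \o lin_ext (fact_act (arr f)))
  (u' := \0 : {linear F0 -> F0})) => b /=.
rewrite !lin_ext_delta; have [y [z [m [h ->]]]] := fact_clsP b.
have [e|ne'] := eqVneq z x'; last by rewrite !fact_act0 // linear0.
by case: _ / e f => f; rewrite !fact_actE lin_ext_delta fact_act0.
Qed.

Lemma fact_act_id v : \sum_y lin_ext (fact_act (arr (fincat_id y))) v = v.
Proof.
rewrite [RHS](delta_decomp v) exchange_big; apply: eq_bigr => b _ /=.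
rewrite -scaler_sumr; congr (_ *: _); have [y [z [m [h ->]]]] := fact_clsP b.
rewrite (bigD1 z) //= big1 => [|u uz]; last by rewrite fact_act0 // eq_sym.
by rewrite addr0 fact_actE fcomp1m.
Qed.

Definition fact_rep : crep C F0 :=
  CRep (fun m => lin_ext_is_linear (fact_act m)) fact_act_comp fact_act_notcomp fact_act_id.

Definition fact_mod := repmod fact_rep.

HB.instance Definition _ := GRing.Lmodule.on fact_mod.

Definition fact_delta (b : facts) : fact_mod := delta k b.

Lemma fact_mod_basis (y z w : ob C) (h : mor z w) (m : mor y z) f :
  catalg_basis k (arr h) *: fact_delta (fact_cls m f) = fact_delta (fact_cls (h \oc m) f).
Proof. by apply: etrans (repmod_basis _ _) _; rewrite /= lin_ext_delta fact_actE. Qed.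

End FactorizationModule.

(** * Injectivity of the multiplication map on factorization classes *)

Section UniqueFactorization.

Variables (k : fieldType) (C : fincat) (hEI : EI C) (hsk : skeletal C).
Variable x : ob C.

Local Notation A := (catalg k C).
Local Notation F := (fact_mod k hEI x).
Local Notation F0 := {ffun facts hEI x -> k^o}.

Definition nonend_pred : {pred A^o} := fun a : A^o => [forall m : arrow C,
  ((a : A) m != 0) ==> ((tag m).1 == x) && ((tag m).2 != x)].

Lemma nonend_predP (a : A^o) :
  reflect (forall u v (h : mor u v), (a : A) (arr h) != 0 -> u = x /\ v != x)
    (a \in nonend_pred).
Proof.
apply: (iffP forallP) => [H u v h ah|H [[u v] h]].
  by have /implyP/(_ ah)/andP[/eqP ux vx] := H (arr h).
by apply/implyP=> /(H u v h) [ux vx]; apply/andP; split=> //; apply/eqP.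
Qed.

(** A morphism that has left [x] cannot return to it, by [EI_antisym]; hence stability under left
    multiplication. *)
Lemma nonend_closed : submod_closed nonend_pred.
Proof.
split=> [|a u v /nonend_predP uP /nonend_predP vP].
  by apply/nonend_predP=> u v h; rewrite ffunE eqxx.
apply/nonend_predP=> p q h; rewrite ffunE => nz.
have [vh0|] := eqVneq ((v : A) (arr h)) 0; last exact: vP.
move: nz; rewrite vh0 addr0 => nz.
suff /andP[/eqP px qx] : (p == x) && (q != x) by split.
apply: contraT => npq; case/negP: nz; apply/eqP.
apply: etrans (catalg_mulE _ _ _) _.
rewrite big1 // => y _; rewrite big1 // => f _; rewrite big1 // => g _.
have [->|] := eqVneq ((u : A) (arr f)) 0; first by rewrite mulr0.
move=> /uP[px yx]; case/negP: npq; rewrite px eqxx /=.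
apply: contraNneq yx => qx; subst p q; apply/eqP; exact: (EI_antisym hEI hsk g f).
Qed.

Local Notation J := (submod nonend_closed).

Definition fact_eval : F0 -> A := lin_ext (fun b => catalg_basis k (arr (fact_val (tagged b)))).

HB.instance Definition _ := GRing.Linear.on fact_eval.

Lemma fact_eval_delta (y z : ob C) (m : mor y z) (f : irr_mor x y) :
  fact_eval (delta k (fact_cls hEI m f)) = catalg_basis k (arr (m \oc val f)).
Proof.
rewrite /fact_eval lin_ext_delta; congr catalg_basis.
exact: (congr1 (@arr C x z) (fact_valE hEI m f)).
Qed.

Lemma fact_eval_basis m (v : F0) :
  fact_eval (lin_ext (@fact_act k C hEI x m) v) = catalg_basis k m * fact_eval v.
Proof.
have ll : linear (fun v : F0 => catalg_basis k m * fact_eval v).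
  by move=> c u w; rewrite linearP mulrDr -catalg_scalerAr.
apply: (delta_ext (u := fact_eval \o lin_ext (@fact_act k C hEI x m))
  (u' := linear_fun ll)) => b /=.
rewrite /linear_fun lin_ext_delta; have [y [z [n [f ->]]]] := fact_clsP b.
rewrite fact_eval_delta; case: m {ll b} => [[u w] h].
rewrite -[existT _ _ _]/(arr h); have [e|ne] := eqVneq z u.
  by subst z; rewrite fact_actE fact_eval_delta catalg_basis_comp fcompA.
by rewrite fact_act0 // linear0 catalg_basis_notcomp.
Qed.

Lemma fact_eval_scale (a : A) (v : F) : fact_eval (a *: v) = a * fact_eval v.
Proof.
rewrite repmodE linear_sum [a in RHS]catalg_decomp mulr_suml.
apply: eq_bigr => m _ /=; rewrite linearZ -catalg_scalerAl; congr (_ *: _).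
exact: fact_eval_basis.
Qed.

Lemma fact_eval_in (v : F0) : (fact_eval v : A^o) \in nonend_pred.
Proof.
apply/nonend_predP=> p q h; rewrite /fact_eval /lin_ext sum_ffunE => nz.
suff /andP[/eqP px qx] : (p == x) && (q != x) by split.
apply: contraT => npq; case/negP: nz; apply/eqP.
rewrite big1 // => b _; rewrite 2!ffunE; case: eqP => [e|_]; last exact: mulr0.
have [y [z [m [f eb]]]] := fact_clsP b.
have ep := congr1 (fun m : arrow C => (tag m).1) e.
have eq := congr1 (fun m : arrow C => (tag m).2) e.
case/negP: npq; move: ep eq; rewrite eb /= => -> ->; rewrite eqxx /=.
have /irrP[xy _] := valP f; apply: contraNneq xy => zx; subst z.
by apply/eqP; exact: (EI_antisym hEI hsk (val f) m).
Qed.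

Definition fact_map (v : F) : J := Submod (fact_eval_in v).

Lemma fact_map_is_linear : linear fact_map.
Proof.
move=> a u v; apply: val_inj; rewrite linearP /=.
by rewrite [LHS](linearD fact_eval); congr (_ + _); apply: fact_eval_scale.
Qed.

HB.instance Definition _ := GRing.isLinear.Build A F J *:%R fact_map fact_map_is_linear.

(** By [first_irr] each nonendomorphism out of [x] is the value of some class. *)
Lemma fact_map_surj (a : J) : exists v, fact_map v = a.
Proof.
suff [v va] : exists v : F0, fact_eval v = submod_val a by exists v; apply: val_inj.
case: a => a /= /nonend_predP aP.
rewrite (catalg_decomp (a : A)).
apply: (big_ind (fun c : A => exists v : F0, fact_eval v = c)) => [|u v [u' <-] [v' <-]|m _].
- by exists 0; rewrite linear0.
- by exists (u' + v'); rewrite linearD.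
have [->|] := eqVneq ((a : A) m) 0; first by exists 0; rewrite linear0 scale0r.
case: m => [[u v] h] nz; have [ux vx] := aP u v h nz; subst u.
have [|z [g [f [fi e]]]] := first_irr hEI hsk h; first by rewrite eq_sym.
exists ((a : A) (arr h) *: delta k (fact_cls hEI g (Sub f fi : irr_mor x z))).
by rewrite linearZ /= fact_eval_delta -e.
Qed.

(** The identity of [y] acts as the projection onto the classes with target [y]. *)
Lemma fact_act_id_supp (y : ob C) (v : F0) b :
  (tag b).2 != y -> lin_ext (@fact_act k C hEI x (arr (fincat_id y))) v b = 0.
Proof.
move=> yb; rewrite sum_ffunE big1 // => b' _; rewrite ffunE.
have [p [q [n [g ->]]]] := fact_clsP b'; have [e|ne] := eqVneq q y; last first.
  by rewrite fact_act0 // ffunE scaler0.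
subst q; rewrite fact_actE ffunE; case: eqP => [e|_]; last exact: mulr0.
by rewrite e eqxx in yb.
Qed.

(* A section [s] of [fact_map] makes [w = v - s (fact_map v)] idempotent, and it maps a generator
   [1, f] to a combination of classes [m', f'] with a strictly smaller middle object. *)
Lemma fact_map_inj : projective J -> injective fact_map.
Proof.
move=> pJ; have [s sK] := pJ F J fact_map idfun fact_map_surj.
pose Phi (v : F) : F := v - s (fact_map v).
have PhiZ a v : Phi (a *: v) = a *: Phi v 
    by rewrite /Phi [fact_map _]linearZ /= [s _]linearZ /= scalerBr.
have PhiD u v : Phi (u + v) = Phi u + Phi v.
  by rewrite /Phi [fact_map _]linearD /= [s _]linearD /= opprD addrACA.
have muPhi v : fact_map (Phi v) = 0 by rewrite /Phi [LHS]linearB /= sK subrr.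
have Phi_id v : Phi (Phi v) = Phi v by rewrite {1}/Phi muPhi [s _]linear0 subr0.
have Phi0 : Phi 0 = 0 by rewrite /Phi [fact_map _]linear0 [s _]linear0 subr0.
suff Phi_delta b : Phi (fact_delta k b) = 0.
  have Phi_all v : Phi v = 0.
    rewrite (delta_decomp (v : F0)).
    apply: (big_ind (fun u : F => Phi u = 0)) => // [u w pu pw|b _].
      by rewrite PhiD pu pw addr0.
    by rewrite -(repmod_scalar (r := fact_rep k hEI x)) PhiZ Phi_delta scaler0.
  move=> u v e; have := Phi_all u; have := Phi_all v.
  by rewrite /Phi e => /subr0_eq v0 /subr0_eq u0; apply: etrans u0 (esym v0).
have [y [z [m [f ->]]]] := fact_clsP b.
have [n] := ubnP (rank y); elim: n y z m f => // n IH y z m f; rewrite ltnS => yn.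
(* Since [[m, f] = m [1, f]] and [Phi] is linear, only the class [[1, f]] has to be treated. *)
have [kap kapE] : {v : F | v = Phi (fact_delta k (fact_cls hEI (fincat_id y) f))} by eexists.
suff kap0 : kap = 0 by rewrite -(fcompm1 m) -fact_mod_basis PhiZ -kapE kap0 scaler0.
have kap_id : kap = lin_ext (@fact_act k C hEI x (arr (fincat_id y))) (kap : F0).
  have {1}-> : kap = catalg_basis k (arr (fincat_id y)) *: kap.
    by rewrite kapE -PhiZ fact_mod_basis fcomp1m.
  exact: repmod_basis.
have kapz b' : (kap : F0) b' != 0 -> (tag b').2 = y.
  by move=> nz; apply/eqP; apply: contraNT nz => ne; rewrite kap_id fact_act_id_supp.
(* The coefficient of a class [[g, f']] with middle object [y] equals that of [g f'] in
   [fact_eval kap], which is 0: no other class in the support of [kap] evaluates to [g f']. *)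
have kapy b' : (kap : F0) b' != 0 -> (tag b').1 != y.
  move=> nz; apply: contraNneq (nz) => b'y; have b'z := kapz _ nz.
  have [y' [z' [g [f' eb']]]] := fact_clsP b'.
  rewrite eb' /= in b'y b'z *; subst y' z'.
  have mk0 : fact_eval (kap : F0) (arr (g \oc val f')) = 0.
    have muk : fact_map kap = 0 by rewrite kapE muPhi.
    have e := congr1 (fun a : J => (submod_val a : A) (arr (g \oc val f'))) muk.
    by apply: etrans e _; rewrite /= ffunE.
  apply/eqP; apply: etrans mk0.
  rewrite /fact_eval /lin_ext sum_ffunE (bigD1 (fact_cls hEI g f')) //= big1 => [|c cne].
    rewrite 2!ffunE (_ : _ == _) ?addr0; first by rewrite [RHS]mulr1.
    by apply/eqP; exact: esym (congr1 (@arr C x y) (fact_valE hEI g f')).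
  rewrite 2!ffunE; have [->|/kapz] := eqVneq ((kap : F0) c) 0; first exact: mul0r.
  case: eqP => [e|_ _]; last exact: mulr0.
  move=> cz; case/negP: cne; apply/eqP.
  have [p [q [h [f2 ec]]]] := fact_clsP c; subst c; rewrite /= in cz; subst q.
  (* [g f'] is irreducible, so its factorization [h f2] also has middle object [y], and both classes
     equal [[1, g f']]. *)
  have fi := irr_compl hEI g (valP f').
  have e' : g \oc val f' = h \oc val f2.
    by apply: arr_inj; apply: etrans e _; exact: (congr1 (@arr C x y) (fact_valE hEI h f2)).
  have py : p = y by rewrite e' in fi; apply: (irr_comp_tgt fi); case/irrP: (valP f2).
  subst p; rewrite -[g]fcomp1m -[h]fcomp1m !fact_cls_bal; congr fact_cls; apply: val_inj.
  by rewrite /= e'.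
(* Only classes with a middle object of rank below that of [y] remain in [kap], and the induction
   hypothesis says that [Phi] kills them. *)
have -> : kap = Phi kap by rewrite kapE Phi_id.
rewrite {1}(delta_decomp (kap : F0)).
apply: (big_ind (fun u : F => Phi u = 0)) => // [u w pu pw|c _].
  by rewrite PhiD pu pw addr0.
have [->|nz] := eqVneq ((kap : F0) c) 0; first by rewrite scale0r.
rewrite -(repmod_scalar (r := fact_rep k hEI x)) PhiZ.
have cy := kapy _ nz; have cz := kapz _ nz; have [p [q [h [f2 ec]]]] := fact_clsP c.
rewrite ec /= in cy cz *; subst q; rewrite IH ?scaler0 //.
exact: leq_trans (rank_lt hEI hsk h cy) yn.
Qed.

(** The classes [[m, f]] and [[m', f']] have the same value, so they coincide by [fact_map_inj]. *)
Lemma right_ufp : hereditary A -> forall (y y' z : ob C) (m : mor y z) (m' : mor y' z)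
  (f : mor x y) (f' : mor x y'), irr f -> irr f' -> m \oc f = m' \oc f' ->
  exists g : mor y y', y = y' /\ m = m' \oc g /\ g \oc f = f'.
Proof.
move=> hA y y' z m m' f f' fi fi' e.
apply: (@fact_cls_inj C hEI x y y' z m m' (Sub f fi) (Sub f' fi')).
apply: (@delta_inj k); apply: fact_map_inj; first exact: hereditary_left_ideal.
apply: val_inj; apply: etrans (fact_eval_delta _ _) _.
by apply: etrans _ (esym (fact_eval_delta _ _)); rewrite e.
Qed.

End UniqueFactorization.

(** * The quiver of irreducible morphisms *)

Section FreeFromUniqueFactorization.

Variables (C : fincat) (hEI : EI C) (hsk : skeletal C).

Hypothesis right_ufp : forall (x y y' z : ob C) (m : mor y z) (m' : mor y' z)
  (f : mor x y) (f' : mor x y'), irr f -> irr f' -> m \oc f = m' \oc f' ->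
  exists g : mor y y', y = y' /\ m = m' \oc g /\ g \oc f = f'.

(** Induction on the rank gap: [right_ufp] matches the first irreducibles of [m] and [m'] up to an
    automorphism, and removing them brings the source closer to [z]. *)
Lemma left_ufp (x y y' z : ob C) (f : mor y z) (f' : mor y' z)
    (m : mor x y) (m' : mor x y') :
  irr f -> irr f' -> f \oc m = f' \oc m' ->
  exists g : mor y y', y = y' /\ f = f' \oc g /\ g \oc m = m'.
Proof.
move=> fi fi'; have [n] := ubnP (rank z - rank x); elim: n x m m' => // n IH x m m'.
rewrite ltnS => zx e.
have /irrP[yz _] := fi; have /irrP[yz' _] := fi'.
(* If [m] is an automorphism, then [f m] is irreducible, which forces [m'] to be an automorphism
   too. *)
have [xy|xy] := eqVneq x y; first subst y.
  have fmi : irr (f' \oc m') by rewrite -e; apply: irr_compr.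
  have xy' := irr_comp_src fmi yz'.
  subst y'; exists (m' \oc endo_inv m); split=> //.
  by rewrite fcompA -e endo_invmV // -fcompA endo_invVm ?fcompm1.
have [xy'|xy'] := eqVneq x y'; first subst y'.
  have fmi : irr (f \oc m) by rewrite e; apply: irr_compr.
  by rewrite (irr_comp_src fmi yz) eqxx in xy.
have [u [p [h [hi em]]]] := first_irr hEI hsk m xy.
have [u' [p' [h' [hi' em']]]] := first_irr hEI hsk m' xy'.
rewrite {}em {}em' !fcompA in e *.
have [g [uu [eg gh]]] := right_ufp hi hi' e; subst u'.
have [||j [yy [fj jp]]] := IH u p (p' \oc g); last first.
- by exists j; split=> //; split=> //; rewrite fcompA jp -fcompA gh.
- by rewrite eg fcompA.
have xu : (rank x < rank u)%N by apply: (rank_lt hEI hsk h); have /irrP[] := hi.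
have uz : (rank u < rank z)%N.
  apply: (leq_ltn_trans _ (rank_lt hEI hsk f yz)).
  by have [->//|uy] := eqVneq u y; apply: ltnW; apply: (rank_lt hEI hsk p uy).
apply: leq_trans zx; exact: ltn_sub2l (ltn_trans xu uz) xu.
Qed.

(** One arrow for each pair of objects joined by an irreducible; the biset on the arrow holds all
    irreducibles between them. *)
Definition irr_arrow : finType :=
  {p : ob C * ob C | [exists f : mor p.1 p.2, irr f]}.

Definition irr_src (a : irr_arrow) : ob C := (val a).1.
Definition irr_tgt (a : irr_arrow) : ob C := (val a).2.

Lemma irr_arrow_rank (a : irr_arrow) : (rank (irr_src a) < rank (irr_tgt a))%N.
Proof. by have /existsP[f /irrP[ne _]] := valP a; apply: (rank_lt hEI hsk f ne). Qed.

Lemma irr_path_rank v w (p : dpath irr_src irr_tgt v w) : (rank v < rank w)%N.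
Proof.
elim: p => [a|v' a p IH]; first exact: irr_arrow_rank.
exact: ltn_trans IH (irr_arrow_rank a).
Qed.

Lemma irr_acyclic v (p : dpath irr_src irr_tgt v v) : False.
Proof. by have := irr_path_rank p; rewrite ltnn. Qed.

Definition irr_quiver : EIquiver :=
  EIQuiver irr_acyclic (qgrp := endo hEI) (fun a => irr_biset hEI (irr_src a) (irr_tgt a)).

Local Notation Q := irr_quiver.
Local Notation path := (dpath (@qsrc Q) (@qtgt Q)).

Fixpoint path_val (v w : ob C) (p : path v w) : Hpath p -> mor v w :=
  match p in dpath _ _ v w return Hpath p -> mor v w with
  | parr a => fun x => val (x : irr_mor _ _)
  | pcons v a p => fun x =>
      val ((brep x).1 : irr_mor _ _) \oc path_val (brep x).2
  end.

(** Compatibility with the left action comes first, since [path_val_pcons] needs it for independence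
    of the representative. *)
Lemma path_val_lact v w (p : path v w) (g : endo hEI w) (x : Hpath p) :
  path_val (blact g x) = (g : mor w w) \oc path_val x.
Proof.
elim: p g x => [a|v' a p IH] g x //=; rewrite /bprod_lact.
apply: etrans (bprod_factor (X := qbis a) (Y := Hpath p)
  (F := fun (b : irr_mor _ _) z => val b \oc path_val z) _ _ _) _.
  by move=> b j z /=; rewrite IH fcompA.
by rewrite /= fcompA.
Qed.

Lemma path_val_pcons v (a : qarr Q) (p : path v (qsrc a)) (f : qbis a) (z : Hpath p) :
  path_val (p := pcons a p) (bcls f z) = val (f : irr_mor _ _) \oc path_val z.
Proof.
apply: (bprod_factor (X := qbis a) (Y := Hpath p)
  (F := fun (b : irr_mor _ _) z => val b \oc path_val z)) => b j {}z /=.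
by rewrite path_val_lact fcompA.
Qed.

Lemma path_val_ract v w (p : path v w) (x : Hpath p) (g : endo hEI v) :
  path_val (bract x g) = path_val x \oc (g : mor v v).
Proof.
elim: p x g => [a|v' a p IH] x g //; have [f [z ->]] := bprodP x.
rewrite [bract _ _]bprod_ractE.
by apply: etrans (path_val_pcons _ _) _; rewrite IH fcompA -(path_val_pcons f z).
Qed.

Lemma path_val_Hcomp u v w (p2 : path v w) (p1 : path u v) (x : Hpath p2) (y : Hpath p1) :
  path_val (Hcomp x y) = path_val x \oc path_val y.
Proof.
elim: p2 p1 x y => [a|v' a p2 IH] p1 x y; first exact: path_val_pcons.
have [f [z ->]] := bprodP x; rewrite [Hcomp _ _]Hcomp_pcons.
by apply: etrans (path_val_pcons _ _) _; rewrite IH fcompA -(path_val_pcons f z).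
Qed.

Definition hom_val (v w : ob C) (h : qhom (Q := Q) v w) : mor v w :=
  match h in qhom v w return mor (f := C) v w with
  | QEnd v x => x
  | QPath v w p x => path_val x
  end.

Lemma hom_val_comp u v w (h2 : qhom (Q := Q) v w) (h1 : qhom u v) :
  hom_val (qcomp h2 h1) = hom_val h2 \oc hom_val h1.
Proof.
case: h2 h1 => [{}v a|{}v {}w p2 x] h1.
  by case: h1 a => [{}u b|{}u {}v p1 y] a //=; rewrite path_val_lact.
by case: h1 p2 x => [{}u b|{}u {}v p1 y] p2 x /=;
  rewrite ?path_val_ract ?path_val_Hcomp.
Qed.

(** [first_irr] provides the first arrow of a path, and the rest of the morphism has a smaller rank
    gap. *)
Lemma hom_val_full v w (f : mor v w) : exists h, @hom_val v w h = f.
Proof.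
have [n] := ubnP (rank w - rank v); elim: n v f => // n IH v f.
rewrite ltnS => wv; have [e|ne] := eqVneq v w.
  by subst w; exists (QEnd (f : qgrp (e := Q) v)).
have [u [g [h [hi ->]]]] := first_irr hEI hsk f ne.
have hP : [exists h : mor (v, u).1 (v, u).2, irr h] by apply/existsP; exists h.
pose a : qarr Q := Sub (v, u) hP; pose h' : Hpath (parr a) := Sub h hi : irr_mor v u.
have vu : (rank v < rank u)%N by apply: (rank_lt hEI hsk h); have /irrP[] := hi.
have [|g' <-] := IH u g; last by exists (qcomp g' (QPath h')); rewrite hom_val_comp.
apply: leq_trans wv; apply: ltn_sub2l (vu); exact: (rank_lt hEI hsk f).
Qed.

Local Notation ptot v w := {p : path v w & Hpath p}.

(** Bundling ends, path and element allows comparison of elements over different paths without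
    transport. *)
Definition alltot : Type := {e : ob C * ob C & ptot e.1 e.2}.

Definition tot v w (p : path v w) (x : Hpath p) : alltot :=
  existT (fun e : ob C * ob C => ptot e.1 e.2) (v, w) (existT _ p x).

Lemma irr_arrow_src_inj (a b : irr_arrow) :
  irr_src a = irr_src b -> irr_tgt a = irr_tgt b -> a = b.
Proof.
move=> es et; apply: val_inj; rewrite [LHS]surjective_pairing [RHS]surjective_pairing.
by congr (_, _).
Qed.

Lemma path_val_neq v w (p : path v w) : v != w.
Proof. by apply: contraTneq (irr_path_rank p) => ->; rewrite ltnn. Qed.

(** The composite along a path of length at least two is reducible. *)
Lemma irr_not_path_val (a b : qarr Q) v (p : path v (qsrc a)) (x : Hpath (pcons a p))
    (y : qbis b) :
  arr (path_val x) <> arr (path_val (p := parr b) y).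
Proof.
move=> e; have [f [z ex]] := bprodP x; subst x; rewrite path_val_pcons /= in e.
have es := congr1 (fun m : arrow C => (tag m).1) e.
have et := congr1 (fun m : arrow C => (tag m).2) e.
case: b y e es et => -[y w] pb f'; rewrite /irr_tgt /irr_src /= => e es.
case: a p f z e => -[u w'] pa p f z; rewrite /irr_tgt /irr_src /= => e et.
subst v w'; have yi : irr (val (f : irr_mor u w) \oc path_val z).
  by rewrite (arr_inj e); exact: (valP (f' : irr_mor y w)).
have /irrP[uw _] := valP f.
by have := path_val_neq p; rewrite (irr_comp_src yi uw) eqxx.
Qed.

(** [left_ufp] matches the last irreducibles up to an automorphism [g]; the biset product lets [g]
    pass to the rest of the path, where induction applies. *)
Lemma path_val_inj v w (p : path v w) (x : Hpath p) v' w' (p' : path v' w') (x' : Hpath p') :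
  arr (path_val x) = arr (path_val x') -> tot x = tot x'.
Proof.
elim: p x v' w' p' x' => [a|u a p IH] x v' w' p' x' e.
  case: p' x' e => [b|{}v' b p'] x' e.
    have es := congr1 (fun m : arrow C => (tag m).1) e.
    have et := congr1 (fun m : arrow C => (tag m).2) e.
    have ab := irr_arrow_src_inj es et; subst b.
    by congr tot; apply: val_inj; apply: arr_inj e.
  by case: (irr_not_path_val (esym e)).
case: p' x' e => [b|{}v' b p'] x' e; first by case: (irr_not_path_val e).
have [f [z ex]] := bprodP x; have [f' [z' ex']] := bprodP x'; subst x x'.
rewrite !path_val_pcons in e.
have es := congr1 (fun m : arrow C => (tag m).1) e.
have et := congr1 (fun m : arrow C => (tag m).2) e.
move: es et => /= es et; subst v'.
case: a p IH f z e et => -[y t] pa p IH f z; rewrite /irr_tgt /=.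
case: b p' f' z' => -[y' t'] pb p' f' z' e; rewrite /irr_tgt /= => et; subst t'.
have [g [yy [ef gz]]] := left_ufp (valP f) (valP f') (arr_inj e).
rewrite /irr_src /= in yy; subst y'; have pp := bool_irrelevance pa pb; subst pb.
have := IH (blact (g : qgrp (e := Q) y) z) _ _ p' z'.
rewrite path_val_lact gz => /(_ erefl) ptz.
have -> : f = bract (f' : qbis (e := Q) (Sub (y, t) pa)) (g : qgrp (e := Q) y).
  exact: val_inj.
rewrite bcls_eq; have := eq_from_Tagged ptz.
exact: (congr1 (fun q : ptot u y => tot (p := pcons (Sub (y, t) pa) (projT1 q))
  (bcls (Y := Hpath (projT1 q)) f' (projT2 q)))).
Qed.

Lemma hom_val_inj v w : injective (@hom_val v w).
Proof.
move=> h h'; have [e|ne] := eqVneq v w.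
  by subst w; have [a ->] := qhom_end h; have [b ->] := qhom_end h' => /= ->.
have [p [x ->]] := qhom_path h ne; have [p' [x' ->]] := qhom_path h' ne => /= e.
have ptx := path_val_inj (congr1 (@arr C v w) e); have := eq_from_Tagged ptx.
exact: (congr1 (fun q : ptot v w => QPath (projT2 q))).
Qed.

Definition hom_lift v w (f : mor v w) : qhom (Q := Q) v w := sval (cid (hom_val_full f)).

Lemma hom_liftK v w : cancel (@hom_lift v w) (@hom_val v w).
Proof. by move=> f; rewrite /hom_lift; case: cid. Qed.

Lemma ufp_free : free_EI C.
Proof.
have lid (v : ob C) : hom_lift (fincat_id v) = qid (Q := Q) v.
  by apply: hom_val_inj; rewrite hom_liftK.
have lcomp (u v w : ob C) (g : mor v w) (f : mor u v) :
    hom_lift (g \oc f) = qcomp (hom_lift g) (hom_lift f).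
  by apply: hom_val_inj; rewrite hom_val_comp !hom_liftK.
pose G : functor (qcat Q) C := @Functor (qcat Q) C id hom_val (fun=> erefl) hom_val_comp.
pose F : functor C (qcat Q) := @Functor C (qcat Q) id hom_lift lid lcomp.
exists Q, F, G; split=> // -[[v w] f].
  exact: (congr1 (fun f => carr (C := C) f) (hom_liftK f)).
apply: (congr1 (fun f => carr (C := qcat Q) f)).
by apply: hom_val_inj; rewrite hom_liftK.
Qed.

End FreeFromUniqueFactorization.

(** * Orders of endomorphism groups *)

Section InvertibleOrders.

Variables (k : fieldType) (C : fincat) (hEI : EI C) (x : ob C).

Local Notation A := (catalg k C).

Definition endo_sum : A := \sum_(g : mor x x) catalg_basis k (arr g).

Lemma endo_sum_end (f : mor x x) : endo_sum (arr f) = 1.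
Proof.
rewrite sum_ffunE (bigD1 f) //= big1 ?addr0 ?ffunE ?eqxx // => g gf.
by rewrite ffunE (inj_eq (@arr_inj C _ _)) eq_sym (negPf gf).
Qed.

Lemma endo_sum_nonend (u : ob C) (f : mor x u) : u != x -> endo_sum (arr f) = 0.
Proof.
move=> ux; rewrite sum_ffunE big1 // => g _; rewrite ffunE; case: eqP => // e.
by have e' := congr1 (fun m : arrow C => (tag m).2) e; rewrite /= in e'; rewrite e' eqxx in ux.
Qed.

Lemma endo_sum_abs (g : mor x x) : catalg_basis k (arr g) * endo_sum = endo_sum.
Proof.
have gi : injective (fun h : mor x x => g \oc h) := mulgI (g : endo hEI x).
rewrite mulr_sumr /endo_sum [RHS](reindex_inj gi).
by apply: eq_bigr => h _; rewrite catalg_basis_comp.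
Qed.

Definition endo_sum_pred : {pred A^o} := fun a : A^o => `[< exists b : A, a = b * endo_sum >].

Lemma endo_sum_predP (b : A) : (b * endo_sum : A^o) \in endo_sum_pred.
Proof. by apply/asboolP; exists b. Qed.

Lemma endo_sum_closed : submod_closed endo_sum_pred.
Proof.
split=> [|a _ _ /asboolP[b ->] /asboolP[b' ->]].
  by have := endo_sum_predP 0; rewrite mul0r.
by apply/asboolP; exists (a * b + b'); rewrite mulrDl -mulrA.
Qed.

Local Notation I := (submod endo_sum_closed).

Definition mul_by_endo_sum (a : A^o) : I := Submod (endo_sum_predP a).

Lemma mul_by_endo_sum_is_linear : linear mul_by_endo_sum.
Proof. by move=> c a b; apply: val_inj; rewrite linearP /= mulrDl -mulrA. Qed.

HB.instance Definition _ :=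
  GRing.isLinear.Build A A^o I *:%R mul_by_endo_sum mul_by_endo_sum_is_linear.

(** Left invariance makes [y] constant on [End(x)], so each pair [(endo_inv f, f)] adds the same
    term to the coefficient of the identity. *)
Lemma mul_endo_sum_id (y : A) : (forall g : mor x x, catalg_basis k (arr g) * y = y) ->
  (y * endo_sum) (arr (fincat_id x)) = #|mor x x|%:R * y (arr (fincat_id x)).
Proof.
(* In the coefficient of [g y] at [g], only the factorization of [g] through the identity
   contributes. *)
move=> yP; have yg (g : mor x x) : y (arr g) = y (arr (fincat_id x)).
  rewrite -{1}(yP g) [LHS]catalg_mulE (bigD1 x) //= [X in _ + X]big1 => [|u ux]; last first.
    rewrite big1 // => f _; rewrite big1 // => h _; rewrite ffunE.
    case: eqP => [e|_]; last by rewrite mul0r.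
    by have e' := congr1 (fun m : arrow C => (tag m).1) e; rewrite /= in e'; rewrite e' eqxx in ux.
  rewrite addr0 (bigD1 (fincat_id x)) //= [X in _ + X]big1 => [|f fid]; last first.
    rewrite big1 // => h /eqP hf; rewrite ffunE (inj_eq (@arr_inj C _ _)).
    case: eqP => [hg|_]; last by rewrite mul0r.
    case/negP: fid; apply/eqP; rewrite -[f]fcomp1m -(endo_invVm hEI h) -fcompA hf hg.
    by rewrite endo_invVm.
  rewrite addr0 (big_pred1 g) => [|h /=]; last by rewrite fcompm1.
  by rewrite ffunE eqxx mul1r.
apply: etrans (catalg_mulE _ _ _) _.
rewrite (bigD1 x) //= [X in _ + X]big1 ?addr0 => [|u ux]; last first.
  by rewrite big1 // => f _; rewrite big1 // => h _; rewrite endo_sum_nonend // mulr0.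
rewrite -sumr_const mulr_suml; apply: eq_big => // f _.
rewrite (big_pred1 (endo_inv f)) ?endo_sum_end ?yg ?mulr1 ?mul1r // => h /=.
apply/eqP/eqP => [hf|->]; last exact: endo_invVm.
by rewrite -[h]fcompm1 -(endo_invP hEI f).2 fcompA hf fcomp1m.
Qed.

Lemma hereditary_order : hereditary A -> (#|mor x x|%:R : k) \is a GRing.unit.
Proof.
move=> hA.
have surj (s : I) : exists a, mul_by_endo_sum a = s.
  by case: s => s sP; have /asboolP[b e] := sP; exists b; apply: val_inj; rewrite /= e.
have pI : projective I by apply: hereditary_left_ideal.
have [v vK] := pI A^o I mul_by_endo_sum idfun surj.
(* [y] is the value at [endo_sum] of a section [v] of right multiplication by [endo_sum]: linearity
   of [v] makes it left-invariant, and the section property gives [ys]. *)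
pose y : A := v (mul_by_endo_sum 1).
have yP (g : mor x x) : catalg_basis k (arr g) * y = y.
  rewrite /y -[_ * _](linearZ_LR v (catalg_basis k (arr g))) -linearZ_LR.
  by congr (v _); apply: val_inj; rewrite /= mul1r [_ *: _]mulr1 endo_sum_abs.
have ys : y * endo_sum = endo_sum.
  by have := congr1 (@submod_val _ _ _ endo_sum_closed) (vK (mul_by_endo_sum 1)); rewrite /= mul1r.
have := mul_endo_sum_id yP; rewrite ys endo_sum_end unitfE => e.
by apply/eqP => k0; move/eqP: e; rewrite k0 mul0r oner_eq0.
Qed.

End InvertibleOrders.

(** * Free EI categories *)

Section Cocycles.

Variables (k : fieldType) (Q : EIquiver).

Local Notation path := (dpath (@qsrc Q) (@qtgt Q)).

(** All morphisms act on one space; the identity of a vertex acts as an idempotent only, as in a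
    module over the category algebra. *)
Record qrep (X : lmodType k) := QRep {
  qact : forall v w, @qhom Q v w -> X -> X;
  qact_linear : forall v w (h : qhom v w), linear (qact h);
  qact_comp : forall u v w (h : qhom v w) (h' : qhom u v) s,
    qact (qcomp h h') s = qact h (qact h' s)
}.

HB.instance Definition _ X (r : qrep X) v w (h : qhom v w) :=
  GRing.isLinear.Build k X X *:%R (qact r h) (qact_linear r h).

Variables (X Y : lmodType k) (rX : qrep X) (rY : qrep Y).

Variable c0 : forall a : qarr Q, qbis a -> X -> Y.

Arguments c0 {a}.

Hypothesis c0_linear : forall a (x : qbis a), linear (c0 x).
Hypothesis c0_lact : forall a (x : qbis a) g s,
  c0 (blact g x) s = qact rY (QEnd g) (c0 x s).
Hypothesis c0_ract : forall a (x : qbis a) g s,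
  c0 (bract x g) s = c0 x (qact rX (QEnd g) s).

(* The Leibniz rule forces the value on a path; [bprod_factor] makes it well defined. *)
Fixpoint path_der v w (p : path v w) : Hpath p -> X -> Y :=
  match p in dpath _ _ v w return Hpath p -> X -> Y with
  | parr a => fun x => c0 x
  | pcons v a p => fun x s =>
      c0 (brep x).1 (qact rX (QPath (brep x).2) s)
      + qact rY (QPath (p := parr a) (brep x).1) (path_der (brep x).2 s)
  end.

Lemma path_der_linear v w (p : path v w) (x : Hpath p) : linear (path_der x).
Proof.
elim: p x => [a|v' a p IH] x /=; first exact: c0_linear.
move=> c s t; rewrite linearP c0_linear IH linearP scalerDr.
by rewrite -!addrA; congr (_ + _); rewrite addrCA.
Qed.

Lemma path_der_lact v w (p : path v w) (x : Hpath p) g s :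
  path_der (blact g x) s = qact rY (QEnd g) (path_der x s).
Proof.
elim: p x g s => [a|v' a p IH] x g s; first exact: c0_lact.
rewrite [blact g x]/(bprod_lact g x) /bprod_lact.
rewrite [RHS]/= linearD /= -c0_lact -qact_comp.
apply: (bprod_factor (X := qbis a) (Y := Hpath p) (F := fun b z =>
  c0 b (qact rX (QPath z) s) + qact rY (QPath (p := parr a) b) (path_der z s))) => b j z.
by rewrite c0_ract -qact_comp IH -qact_comp.
Qed.

Lemma path_der_pcons v (a : qarr Q) (p : path v (qsrc a)) (b : qbis a) (z : Hpath p) s :
  path_der (p := pcons a p) (bcls b z) s =
  c0 b (qact rX (QPath z) s) + qact rY (QPath (p := parr a) b) (path_der z s).
Proof.
apply: (bprod_factor (X := qbis a) (Y := Hpath p) (F := fun b z =>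
  c0 b (qact rX (QPath z) s) + qact rY (QPath (p := parr a) b) (path_der z s))) => {}b j {}z.
by rewrite c0_ract -qact_comp path_der_lact -qact_comp.
Qed.

Lemma path_der_ract v w (p : path v w) (x : Hpath p) g s :
  path_der (bract x g) s = path_der x (qact rX (QEnd g) s).
Proof.
elim: p x g s => [a|v' a p IH] x g s; first exact: c0_ract.
have [b [z ->]] := bprodP x; rewrite [bract _ _]bprod_ractE.
rewrite [LHS]path_der_pcons [RHS]path_der_pcons IH.
by rewrite -[qact rX (QPath z) _]qact_comp.
Qed.

Lemma path_der_Hcomp u v w (p2 : path v w) (p1 : path u v) (x : Hpath p2) (y : Hpath p1) s :
  path_der (Hcomp x y) s =
  path_der x (qact rX (QPath y) s) + qact rY (QPath x) (path_der y s).
Proof.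
elim: p2 p1 x y => [a|v' a p2 IH] p1 x y; first exact: path_der_pcons.
have [b [z ->]] := bprodP x; rewrite [Hcomp _ _]Hcomp_pcons.
rewrite [LHS]path_der_pcons path_der_pcons IH linearD /= addrA.
by rewrite -[qact rX (QPath z) _]qact_comp -[qact rY (QPath _) (qact rY _ _)]qact_comp.
Qed.

Definition qder v w (h : @qhom Q v w) : X -> Y :=
  match h with QEnd _ _ => fun=> 0 | QPath _ _ _ x => path_der x end.

Lemma qder_linear v w (h : qhom v w) : linear (qder h).
Proof.
by case: h => [{}v g|{}v {}w p x] c s t /=; rewrite ?scaler0 ?addr0 ?path_der_linear.
Qed.

(** Freeness at work: the only relations between arrows are the balancing ones over vertex groups,
    and these are met by [c0_lact] and [c0_ract]. *)
Lemma qder_comp u v w (h : qhom v w) (h' : qhom u v) s :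
  qder (qcomp h h') s = qder h (qact rX h' s) + qact rY h (qder h' s).
Proof.
case: h h' => [{}v a|{}v {}w p2 x] h'.
  by case: h' a => [{}u b|{}u {}v p1 y] a /=; rewrite ?linear0 ?add0r ?path_der_lact.
case: h' p2 x => [{}u b|{}u {}v p1 y] p2 x /=; first by rewrite linear0 addr0 path_der_ract.
exact: path_der_Hcomp.
Qed.

(** A cocycle that is zero on vertex groups is determined by its values on arrows. The map [i]
    allows comparison with a cocycle [D] given only on a subrepresentation. *)
Lemma qder_unique (X' : lmodType k) (rX' : qrep X') (i : X' -> X)
    (D : forall v w, qhom v w -> X' -> Y) :
  (forall v w (h : qhom v w) s, i (qact rX' h s) = qact rX h (i s)) ->
  (forall v g s, D v v (QEnd g) s = 0) ->
  (forall u v w (h : qhom v w) (h' : qhom u v) s,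
     D u w (qcomp h h') s = D v w h (qact rX' h' s) + qact rY h (D u v h' s)) ->
  (forall a (x : qbis a) s, D _ _ (QPath (p := parr a) x) s = c0 x (i s)) ->
  forall v w (h : qhom v w) s, qder h (i s) = D v w h s.
Proof.
move=> iE D0 DM Dc v w h s; case: h => [{}v g|{}v {}w p x] /=; first by rewrite D0.
elim: p x s => [a|v' a p IH] x s; first by rewrite Dc.
have [b [z ->]] := bprodP x; rewrite [LHS]path_der_pcons IH -iE -Dc.
exact: esym (DM _ _ _ (QPath (p := parr a) b) (QPath z) s).
Qed.

(** If the values on arrows lie in the kernel of an equivariant map, the Leibniz rule keeps all
    values there. *)
Lemma qder_vanish (Z : lmodType k) (rZ : qrep Z) (p : {additive Y -> Z}) :
  (forall v w (h : qhom v w) y, p (qact rY h y) = qact rZ h (p y)) ->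
  (forall a (x : qbis a) s, p (c0 x s) = 0) ->
  forall v w (h : qhom v w) s, p (qder h s) = 0.
Proof.
move=> pE pc v w h s; case: h => [{}v g|{}v {}w q x] /=; first by rewrite raddf0.
elim: q x => [a|v' a q IH] x //=.
by rewrite raddfD pE pc IH linear0 addr0.
Qed.

End Cocycles.

(** * Averaging over the endomorphism groups *)

Section Averaging.

Variables (k : fieldType) (C : fincat) (hEI : EI C).

Hypothesis order_unit : forall x : ob C, (#|mor x x|%:R : k) \is a GRing.unit.

Local Notation A := (catalg k C).

Lemma endo_average_id (M : lmodType A) (s : restr M) :
  \sum_(x : ob C) #|mor x x|%:R^-1 *:
    (\sum_(g : mor x x) mact (arr (endo_inv g)) (mact (arr g) s)) = s.
Proof.
rewrite -[RHS]mact_id; apply: eq_bigr => x _.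
under eq_bigr => g _ do rewrite mact_comp (endo_invVm hEI).
by rewrite sumr_const -scaler_nat scalerA mulVr // scale1r.
Qed.

Variables (M N : lmodType A) (u : {linear restr M -> restr N}).

(** Maschke averaging at all objects at once: the summand at [x] involves only the component of [s]
    at [x]. *)
Definition endo_average (s : restr M) : restr N :=
  \sum_(x : ob C) #|mor x x|%:R^-1 *:
    (\sum_(g : mor x x) mact (arr (endo_inv g)) (u (mact (arr g) s))).

Lemma endo_average_linear : linear endo_average.
Proof.
move=> c s t; rewrite scaler_sumr -big_split; apply: eq_bigr => x _.
set F := fun s => \sum_(g : mor x x) mact (arr (endo_inv g)) (u (mact (arr g) s)).
rewrite -[X in X = _]/(_ *: F (c *: s + t)) -[RHS]/(c *: (_ *: F s) + _ *: F t).
have -> : F (c *: s + t) = c *: F s + F t.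
  by rewrite scaler_sumr -big_split; apply: eq_bigr => g _; rewrite !linearP.
by rewrite scalerDr !scalerA mulrC.
Qed.

(** For [x != y] both summands vanish; at [y], replace [g] by [g h] and use [h (g h)^-1 = g^-1]. *)
Lemma endo_average_comm (y : ob C) (h : mor y y) s :
  endo_average (mact (arr h) s) = mact (arr h) (endo_average s).
Proof.
rewrite /endo_average linear_sum; apply: eq_bigr => x _ /=.
rewrite linearZ /=; congr (_ *: _).
rewrite [RHS]linear_sum /=.
have [xy|xy] := eqVneq x y; last first.
  rewrite !big1 // => g _; first by rewrite mact_notcomp.
  by rewrite mact_notcomp 1?eq_sym // linear0 linear0.
subst x; have hi : injective (fun g : mor y y => g \oc h).
  by move=> g g' e; rewrite -(endo_invmV hEI h g) e endo_invmV.
rewrite [RHS](reindex_inj hi); apply: eq_bigr => g _ /=.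
rewrite !mact_comp; congr (mact (arr _) _).
pose G := endo hEI y; have := invMg (g : G) (h : G).
have -> : ((g : G) * (h : G))^-1%g = endo_inv (g \oc h) by [].
move=> ->; rewrite -[RHS]/((h : G) * ((h : G)^-1 * (g : G)^-1))%g.
by rewrite mulgA mulgV mul1g.
Qed.

End Averaging.

(** * Extensions of modules by cocycles *)

Section TwistedModule.

Variables (k : fieldType) (C : fincat).

Local Notation A := (catalg k C).

Variables (M P : lmodType A) (c : arrow C -> restr P -> restr M).

Hypothesis c_linear : forall m, linear (c m).
Hypothesis c_comp : forall (x y z : ob C) (g : mor y z) (f : mor x y) s,
  c (arr (g \oc f)) s = c (arr g) (mact (arr f) s) + mact (arr g) (c (arr f) s).
Hypothesis c_id : forall (x : ob C) s, c (arr (fincat_id x)) s = 0.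

Local Notation MP := (restr M * restr P)%type.

(** The extension of [P] by [M] with cocycle [c]: upper triangular operators with [c m] off the
    diagonal. *)
Definition twist_act (m : arrow C) (e : MP) : MP :=
  (mact m e.1 + c m e.2, mact m e.2).

Lemma twist_linear m : linear (twist_act m).
Proof.
move=> a [x p] [y q]; congr (_, _); rewrite /= linearP // c_linear.
by rewrite scalerDr addrACA.
Qed.

Lemma twist_comp (x y z : ob C) (g : mor y z) (f : mor x y) e :
  twist_act (arr g) (twist_act (arr f) e) = twist_act (arr (g \oc f)) e.
Proof.
case: e => m p; congr (_, _); rewrite /= ?mact_comp // linearD /= mact_comp c_comp.
by rewrite -addrA; congr (_ + _); rewrite addrC.
Qed.

Lemma c_tgt (x y : ob C) (f : mor x y) s :
  mact (arr (fincat_id y)) (c (arr f) s) = c (arr f) s.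
Proof. by have := c_comp (fincat_id y) f s; rewrite fcomp1m c_id add0r. Qed.

Lemma c_src (x y : ob C) (f : mor x y) s :
  c (arr f) (mact (arr (fincat_id x)) s) = c (arr f) s.
Proof. by have := c_comp f (fincat_id x) s; rewrite fcompm1 c_id linear0 addr0. Qed.

Lemma twist_notcomp (x y y' z : ob C) (g : mor y' z) (f : mor x y) e :
  y != y' -> twist_act (arr g) (twist_act (arr f) e) = 0.
Proof.
move=> ne; case: e => m p; congr (_, _); rewrite /= ?mact_notcomp // linearD /=.
rewrite mact_notcomp // add0r -c_tgt mact_notcomp // add0r -c_src.
by rewrite mact_notcomp //; exact: (linear0 (linear_fun (c_linear _))).
Qed.

Lemma twist_id e : \sum_x twist_act (arr (fincat_id x)) e = e.
Proof.
case: e => m p; rewrite [LHS]surjective_pairing; congr (_, _).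
  rewrite (raddf_sum (@fst (restr M) (restr P))) /=.
  by under eq_bigr do rewrite c_id addr0; exact: mact_id.
rewrite (raddf_sum (@snd (restr M) (restr P))) /=.
exact: mact_id.
Qed.

Definition twist_rep : crep C MP := CRep twist_linear twist_comp twist_notcomp twist_id.

Definition twist_snd (e : repmod twist_rep) : P := (e : MP).2.

Lemma twist_snd_is_linear : linear twist_snd.
Proof.
move=> a u v; congr (_ + _); rewrite repmodE /lin_ext.
rewrite /twist_snd (raddf_sum (@snd (restr M) (restr P))) /=.
exact: esym (mactE a _).
Qed.

HB.instance Definition _ :=
  GRing.isLinear.Build A (repmod twist_rep) P *:%R twist_snd twist_snd_is_linear.

(** Every cocycle on a projective module is a coboundary: linearity of a section [p -> (w p, p)] of
    the extension is the stated equation for [w]. *)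
Lemma projective_cocycle : projective P ->
  exists w : {linear restr P -> restr M},
    forall m p, w (mact m p) = mact m (w p) + c m p.
Proof.
move=> pP; have [|w wK] := pP (repmod twist_rep) P twist_snd idfun.
  by move=> p; exists ((0, p) : MP).
have wl : linear (fun p : restr P => (w p : MP).1 : restr M).
  by move=> a p q; rewrite restrE linearP /= repmod_scalar.
exists (linear_fun wl) => m p.
have e : w (mact m p) = twist_act m (w p).
  by apply: etrans (linearZ_LR w (catalg_basis k m) p) _; apply: repmod_basis.
apply: etrans (congr1 fst e) _; congr (_ + c m _); exact: wK.
Qed.

End TwistedModule.

(** * From freeness to heredity *)

Section FreeHereditary.

Variables (k : fieldType) (C : fincat) (hEI : EI C).

Hypothesis order_unit : forall x : ob C, (#|mor x x|%:R : k) \is a GRing.unit.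

Local Notation A := (catalg k C).

Variables (Q : EIquiver) (F : functor C (qcat Q)) (G : functor (qcat Q) C).
Hypothesis FK : cancel (farrow F) (farrow G).

(** Bundled with its ends, so that [qmorK] needs no transport between [x] and its image under both
    functors. *)
Definition qmor v w (h : @qhom Q v w) : arrow C := @carr C _ _ (fmor G h).

Definition qob (v : qvert Q) : ob C := fob G v.

Lemma qmorE v w (h : qhom v w) : exists f : mor (qob v) (qob w), qmor h = arr f.
Proof. by exists (fmor G h). Qed.

Lemma qmor_comp u v w (h : qhom v w) (h' : qhom u v) :
  exists (g : mor (qob v) (qob w)) (f : mor (qob u) (qob v)),
  [/\ qmor h = arr g, qmor h' = arr f & qmor (qcomp h h') = arr (g \oc f)].
Proof.
exists (fmor G h), (fmor G h'); split=> //.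
exact: (congr1 (@carr C (qob u) (qob w)) (@fmor_comp _ _ G u v w h h')).
Qed.

Lemma qmorK (x y : ob C) (f : mor x y) : qmor (fmor F f) = arr f.
Proof. exact: (FK (arr f)). Qed.

Lemma qmact_comp (M : lmodType A) u v w (h : qhom v w) (h' : qhom u v) (s : restr M) :
  mact (qmor (qcomp h h')) s = mact (qmor h) (mact (qmor h') s).
Proof. by have [g [f [-> -> ->]]] := qmor_comp h h'; rewrite mact_comp. Qed.

Definition qrep_of (M : lmodType A) : qrep Q (restr M) :=
  QRep (fun v w (h : qhom v w) => mact_is_linear (M := M) (qmor h)) (@qmact_comp M).

(** [p] and [u] commute with all morphisms, so [p] turns the average of [l] into the average of the
    identity, which [endo_average_id] evaluates, followed by [u]. *)
Lemma endo_average_lift (M N S : lmodType A) (p : {linear M -> N}) (u : {linear S -> N})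
    (l : {linear restr S -> restr M}) :
  (forall s, p (l s) = u s) -> forall s, p (endo_average l s) = u s.
Proof.
move=> lP s; pose p' : {linear restr M -> restr N} := linear_fun (restr_linear p).
pose u' : {linear restr S -> restr N} := linear_fun (restr_linear u).
rewrite -[in RHS](endo_average_id hEI order_unit s).
rewrite -[LHS]/(p' _) -[RHS]/(u' _) /endo_average !linear_sum; apply: eq_bigr => x _.
rewrite !linearZ !linear_sum; congr (_ *: _); apply: eq_bigr => g _.
by rewrite -[LHS]/(p _) -[RHS]/(u _) !mact_linear lP mact_linear.
Qed.

Lemma endo_average_retract (S P : lmodType A) (i : {linear S -> P})
    (t : {linear restr P -> restr S}) :
  cancel i t -> cancel i (endo_average t).
Proof.
move=> tP s; rewrite -[RHS](endo_average_id hEI order_unit (s : restr S)).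
by do 2![apply: eq_bigr => ? _; congr (_ *: _)|apply: eq_bigr => ? _];
  rewrite -mact_linear tP.
Qed.

Lemma free_hereditary : hereditary A.
Proof.
move=> P S i ii pP M N p u ps.
have [l lP] := linear_lifting (restr_linear p) (restr_linear u) ps.
have [t tP] := linear_retraction (restr_linear i) ii.
pose v0 : {linear restr S -> restr M} := linear_fun (endo_average_linear l).
pose r : {linear restr P -> restr S} := linear_fun (endo_average_linear t).
have v0P s : p (v0 s) = u s := endo_average_lift lP s.
have rP s : r (i s) = s := endo_average_retract tP s.
have v0E (x : ob C) (g : mor x x) s : v0 (mact (arr g) s) = mact (arr g) (v0 s).
  exact: endo_average_comm.
have rE (x : ob C) (g : mor x x) s : r (mact (arr g) s) = mact (arr g) (r s).
  exact: endo_average_comm.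
(* The defect of [v0] from linearity; it is a cocycle that vanishes on endomorphisms because [v0]
   commutes with them. *)
pose D m (s : restr S) : restr M := v0 (mact m s) - mact m (v0 s).
have Dl m : linear (D m).
  by move=> a s s'; rewrite /D; do 4!rewrite linearP /=; rewrite scalerBr opprD addrACA.
have DM (x y z : ob C) (g : mor y z) (f : mor x y) s :
    D (arr (g \oc f)) s = D (arr g) (mact (arr f) s) + mact (arr g) (D (arr f) s).
  by rewrite /D linearB /= !mact_comp addrA subrK.
have D0 (x : ob C) (g : mor x x) s : D (arr g) s = 0 by rewrite /D v0E subrr.
(* The retraction [r] carries the defect on arrows from [S] to [P]; equivariance of [D] and [r]
   under endomorphisms gives the balancing conditions. *)
pose c0 (a : qarr Q) (x : qbis a) (s : restr P) : restr M :=
  D (qmor (QPath (p := parr a) x)) (r s).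
have c0l a x : linear (@c0 a x) by move=> b s s'; rewrite /c0 linearP Dl.
have c0_lact a (x : qbis a) g s :
    c0 a (blact g x) s = qact (qrep_of M) (QEnd g) (c0 a x s).
  have [g' [f [/= eg ef egf]]] := qmor_comp (QEnd g) (QPath (p := parr a) x).
  by rewrite /c0 ef egf DM D0 add0r eg.
have c0_ract a (x : qbis a) g s :
    c0 a (bract x g) s = c0 a x (qact (qrep_of P) (QEnd g) s).
  have [f [g' [/= ef eg efg]]] := qmor_comp (QPath (p := parr a) x) (QEnd g).
  by rewrite /c0 ef efg DM D0 linear0 addr0 eg rE.
pose c (m : arrow C) : restr P -> restr M :=
  qder (qrep_of P) (qrep_of M) c0 (@fmor _ _ F (tag m).1 (tag m).2 (tagged m)).
have cl m : linear (c m) by exact: (qder_linear _ _ c0l).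
have cM (x y z : ob C) (g : mor y z) (f : mor x y) s :
    c (arr (g \oc f)) s = c (arr g) (mact (arr f) s) + mact (arr g) (c (arr f) s).
  rewrite /c /= [fmor F _]fmor_comp [cat_comp _ _]/(qcomp (fmor F g) (fmor F f)).
  by rewrite (qder_comp c0_lact c0_ract) /= !qmorK.
have c_id (x : ob C) s : c (arr (fincat_id x)) s = 0.
  by rewrite /c /= [fmor F _]fmor_id.
(* On [S] the extended cocycle is [D] again, since [r] is the identity there and arrows determine a
   cocycle. *)
have cD m s : c m (i s) = D m s.
  rewrite /c (qder_unique c0_lact c0_ract (rX' := qrep_of S) (D := fun v w h => D (qmor h))) //.
  - by case: m => [[x y] f]; rewrite /= qmorK.
  - by move=> v w h s'; rewrite /= mact_linear.
  - by move=> v g s'; have [f ->] := qmorE (QEnd g); rewrite D0.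
  - by move=> u0 v w h h' s'; have [f [g [/= -> -> ->]]] := qmor_comp h h'; rewrite DM.
  - by move=> a x s'; rewrite /c0 rP.
have pD m s : p (D m s) = 0.
  apply: etrans (linearB p (v0 (mact m s)) (mact m (v0 s))) _.
  apply: etrans (congr2 (fun a b : N => a - b) (v0P _)
    (etrans (mact_linear p m _) (congr1 (@mact k C N m) (v0P s)))) _.
  by rewrite [u _]mact_linear; apply: subrr.
have pc m s : p (c m s) = 0.
  pose p' : {linear restr M -> restr N} := linear_fun (restr_linear p).
  apply: (qder_vanish (qrep_of P) (rY := qrep_of M) (rZ := qrep_of N) (p := p')
    (c0 := c0)) => [v w h y|a x s']; last exact: pD.
  exact: (mact_linear p).
have [w wP] := projective_cocycle cl cM c_id pP.
(* The values of [c] lie in the kernel of [p], so [p w] is linear over the algebra although [w] is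
   not assumed to be; it therefore lifts to a linear [w2]. *)
have pwl : linear (fun s : P => p (w s)).
  apply: (@mact_linearI k C P N) => [|m s].
    by move=> a s s'; rewrite [w _]linearP; exact: restr_linear.
  rewrite wP; apply: etrans (linearD p (mact m (w s)) (c m s)) _.
  apply: etrans (congr2 (fun a b : N => a + b) (mact_linear p m _) (pc m s)) _.
  exact: addr0.
have [w2 w2P] := pP M N p (linear_fun pwl) ps.
pose w2' : {linear restr P -> restr M} := linear_fun (restr_linear w2).
pose i' : {linear restr S -> restr P} := linear_fun (restr_linear i).
(* Subtracting [w i] cancels the defect of [v0] but changes its image under [p] by [p w i]; adding
   the linear map [w2 i] restores [p v = u]. *)
pose v : {linear restr S -> restr M} := v0 \- (w \o i') \+ (w2' \o i').
have vl : linear (v : S -> M).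
  apply: (@mact_linearI k C S M) => [|m s]; first exact: linearP.
  have iE : i' (mact m s) = mact m (i' s) := mact_linear i m s.
  have w2E : w2' (mact m (i' s)) = mact m (w2' (i' s)) := mact_linear w2 m (i' s).
  have cE : c m (i' s) = v0 (mact m s) - mact m (v0 s) := cD m s.
  have mE (a b d : restr M) : mact m (a - b + d) = mact m a - mact m b + mact m d.
    by rewrite linearD linearB.
  have vE s' : v s' = v0 s' - w (i' s') + w2' (i' s') by [].
  rewrite !vE iE w2E wP cE mE.
  by congr (_ + _); rewrite opprD opprB addrCA [X in _ + X]addrCA subrr addr0 addrC.
exists (linear_fun vl) => s.
apply: etrans (linearD p (v0 s - w (i s) : restr M) (w2 (i s))) _.
apply: etrans (congr2 (fun a b : N => a + b)
  (etrans (linearB p (v0 s) (w (i s))) (congr1 (fun a : N => a - p (w (i s))) (v0P s)))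
  (w2P (i s))) _.
exact: subrK.
Qed.

End FreeHereditary.

Theorem theorem1p2 (k : closedFieldType) (C : fincat) :
  EI C -> skeletal C -> cat_connected C ->
  (hereditary (catalg k C) <->
   free_EI C /\
   forall x : ob C, (#|mor x x|%:R : k) \is a GRing.unit).
Proof.
move=> hEI hsk _; split=> [hA|[[Q [F [G [_ _ FK _]]]] order_unit]].
  split=> [|x]; last exact: hereditary_order.
  by apply: (ufp_free hEI hsk) => x y y' z m m' f f'; apply: right_ufp hA _ _ _ _ _ _ _.
exact: (free_hereditary hEI order_unit FK).
Qed.
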